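(* Let $\eta$ be an $H_n$-invariant, log-concave, isotropic probability measure on $\mathbb{R}^n$, and let $f$ be a homogeneous cubic polynomial on $\mathbb{R}^n$ with $\mathrm{coeff}_3(f)=1$. Then $$\mathbb{E}_\eta[f^2]\ge\frac{108}{175}+O(n^{-1}),$$ where the constant implied by $O(n^{-1})$ is absolute.
   Context: $\eta$ is $H_n$-invariant if it is invariant under all coordinate permutations and all reflections $x_i\mapsto-x_i$. It is isotropic if centered with identity covariance matrix, and log-concave if absolutely continuous with density $e^{-\varphi}$ for some convex $\varphi:\mathbb{R}^n\to(-\infty,\infty]$. For $f=\sum_{|I|=3}\alpha_Ix^I$, $\mathrm{coeff}_3(f)=\sqrt{\sum_{|I|=3}\alpha_I^2}$. *)

(* Defs.v *)
From HB Require Import structures.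
From mathcomp Require Import all_boot all_order all_algebra all_fingroup.
(* The notations of mpoly clash with those of mathcomp-analysis, hence the
   import filter; [mpoly n R] is the type otherwise written {mpoly R[n]}. *)
From mathcomp Require Import -(notations) mpoly.
From mathcomp Require Import all_classical all_reals all_analysis.
From mathcomp Require Import measurable_realfun.

Set Implicit Arguments.
Unset Strict Implicit.
Unset Printing Implicit Defensive.

Import Order.TTheory GRing.Theory Num.Theory.
Import numFieldNormedType.Exports.

Local Open Scope classical_set_scope.
Local Open Scope ring_scope.

(* Throughout, R^n is [n.-tuple R] with its product sigma-algebra, which is the
   Borel sigma-algebra of R^n. *)

(* Lebesgue measure on R^n: the Dirac mass at the empty tuple for n = 0, and the
   image of the product of Lebesgue measure on R and Lebesgue measure on R^n
   under (x, v) |-> x :: v for n + 1. *)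
Section lebesgue_tuple.
Variable R : realType.

Definition tcons n (p : measurableTypeR R * n.-tuple R) : n.+1.-tuple R :=
  [tuple of (p.1 : R) :: p.2].

Lemma measurable_tcons n : measurable_fun setT (@tcons n).
Proof.
by apply: measurable_cons; [exact: measurable_fst|exact: measurable_snd].
Qed.

Section step.
Variables (n : nat) (mu : {sigma_finite_measure set (n.-tuple R) -> \bar R}).

Let nu : {measure set (measurableTypeR R * n.-tuple R)%type -> \bar R} :=
  (@lebesgue_measure R \x mu)%E.

Definition lebesgue_tupleS : set (n.+1.-tuple R) -> \bar R :=
  pushforward nu (@tcons n).

Let lebesgue_tupleS0 : lebesgue_tupleS set0 = 0%E.
Proof. by rewrite /lebesgue_tupleS /pushforward preimage_set0 measure0. Qed.

Let lebesgue_tupleS_ge0 A : (0 <= lebesgue_tupleS A)%E.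
Proof. by rewrite /lebesgue_tupleS /pushforward measure_ge0. Qed.

Let measurable_preimage A : measurable A -> measurable (@tcons n @^-1` A).
Proof. by move=> mA; rewrite -[X in measurable X]setTI; exact: measurable_tcons. Qed.

Let lebesgue_tupleS_sigma_additive : semi_sigma_additive lebesgue_tupleS.
Proof.
move=> F mF tF mUF; rewrite /lebesgue_tupleS /pushforward preimage_bigcup.
apply: (@measure_semi_sigma_additive _ _ _ nu).
- by move=> k; exact: measurable_preimage.
- apply/trivIsetP => /= i j _ _ ij; rewrite -preimage_setI.
  by move/trivIsetP : tF => /(_ _ _ _ _ ij) ->//; rewrite preimage_set0.
- by rewrite -preimage_bigcup; exact: measurable_preimage.
Qed.

HB.instance Definition _ := isMeasure.Build _ _ _ lebesgue_tupleS
  lebesgue_tupleS0 lebesgue_tupleS_ge0 lebesgue_tupleS_sigma_additive.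

Let lebesgue_tupleS_sigma_finite : sigma_finite setT lebesgue_tupleS.
Proof.
have /sigma_finiteP[F [TF ndF Foo]] := sigma_finiteT (@lebesgue_measure R).
have /sigma_finiteP[G [TG ndG Goo]] := sigma_finiteT mu.
pose hd (v : n.+1.-tuple R) : measurableTypeR R * n.-tuple R :=
  (thead v, [tuple of behead v]).
have hdK : cancel (@tcons n) hd.
  by move=> [x v]; congr pair; rewrite ?theadE//; exact/val_inj.
have mhd : measurable_fun setT hd.
  apply/measurable_fun_pairP; split.
    exact: measurable_tnth.
  exact: measurable_behead.
exists (fun k => hd @^-1` (F k `*` G k)).
  rewrite -preimage_bigcup predeqE => v; split => // _.
  have [k _ Fk] : (\bigcup_k F k) (hd v).1 by rewrite -TF.
  have [l _ Gl] : (\bigcup_k G k) (hd v).2 by rewrite -TG.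
  exists (maxn k l) => //; split.
  - by move: Fk; exact/subsetPset/ndF/leq_maxl.
  - by move: Gl; exact/subsetPset/ndG/leq_maxr.
move=> k; have [mF Fk] := Foo k; have [mG Gk] := Goo k; split.
  by rewrite -[X in measurable X]setTI; apply: mhd => //; exact: measurableX.
rewrite /lebesgue_tupleS /pushforward -comp_preimage.
rewrite (_ : hd \o @tcons n = idfun) ?preimage_id; last exact/funext.
by rewrite [X in (X < _)%E]product_measure1E// lte_mul_pinfty// ge0_fin_numE.
Qed.

HB.instance Definition _ := Measure_isSigmaFinite.Build _ _ _ lebesgue_tupleS
  lebesgue_tupleS_sigma_finite.

End step.

Fixpoint lebesgue_tuple n : {sigma_finite_measure set (n.-tuple R) -> \bar R} :=
  match n with
  | 0 => dirac ([tuple] : 0.-tuple R)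
  | k.+1 => lebesgue_tupleS (lebesgue_tuple k)
  end.

End lebesgue_tuple.

Section hyperoctahedral.
Variables (R : realType) (n : nat).
Implicit Types (x : n.-tuple R) (eta : {measure set (n.-tuple R) -> \bar R}).

Definition permute (s : {perm 'I_n}) x : n.-tuple R :=
  [tuple tnth x (s i) | i < n].

Definition reflect_coord (i : 'I_n) x : n.-tuple R :=
  [tuple if j == i then - tnth x j else tnth x j | j < n].

Definition invariant_under (T : n.-tuple R -> n.-tuple R) eta :=
  forall A, measurable A -> pushforward eta T A = eta A.

Definition Hn_invariant eta :=
  (forall s, invariant_under (permute s) eta) /\
  (forall i, invariant_under (reflect_coord i) eta).

End hyperoctahedral.

Definition isotropic (R : realType) (n : nat)
    (eta : probability (n.-tuple R) R) :=
  (forall i : 'I_n, 'E_eta[fun x => tnth x i] = 0)%E /\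
  (forall i j : 'I_n, covariance eta (fun x => tnth x i) (fun x => tnth x j)
                      = ((i == j)%:R : R)%:E).

Section log_concave.
Variables (R : realType) (n : nat).

Definition tconv (t : R) (x y : n.-tuple R) : n.-tuple R :=
  [tuple t * tnth x i + (1 - t) * tnth y i | i < n].

(* Convexity for functions with values in (-oo, +oo]; recall 0 * +oo = 0. *)
Definition econvex (phi : n.-tuple R -> \bar R) :=
  (forall x, phi x != -oo%E) /\
  (forall (t : R) (x y : n.-tuple R), 0 <= t <= 1 ->
     (phi (tconv t x y) <= t%:E * phi x + (1 - t)%:E * phi y)%E).

(* The density expeR (- phi) is, as any density, a measurable function. *)
Definition log_concave (eta : {measure set (n.-tuple R) -> \bar R}) :=
  exists phi : n.-tuple R -> \bar R,
    [/\ econvex phi, measurable_fun [set: n.-tuple R] phi &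
        forall A, measurable A ->
          eta A = (\int[lebesgue_tuple R n]_(x in A) expeR (- phi x))%E].

End log_concave.

(* [bmultinom n 4] is the finite type of multi-indices of degree < 4. *)
Definition coeff3 (R : realType) (n : nat) (f : mpoly n R) : R :=
  Num.sqrt (\sum_(I : bmultinom n 4 | mdeg I == 3%N) mcoeff I f ^+ 2).

(* Main.v *)
Require Import Defs.
From HB Require Import structures.
From mathcomp Require Import all_boot all_order all_algebra all_fingroup.
From mathcomp Require Import -(notations) mpoly.
From mathcomp Require Import all_classical all_reals all_analysis.
From mathcomp Require Import measurable_realfun.
From mathcomp Require Import zify ring lra.

(** Write N for the dimension and m_ijk for the expectation of
x_i^2 x_j^2 x_k^2.  Invariance under reflections makes E[x^I x^J] vanish
unless I and J have the same parities in every coordinate, so E[f^2] is a sum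
of quadratic forms, one for each parity class of cubic monomials.  The class of
a three-element set {i,j,k} contains only x_i x_j x_k, with second moment
m_ijk.  The class of {i} consists of the x_i x_j^2, and its form
E[x_i^2 (sum_j B_j x_j^2)^2] = sum_jk B_j B_k m_ijk involves, by invariance
under permutations, only M = m_iii, p = m_iij and q = m_ijk: with a = B_i, S
the sum and b2 the sum of squares of the other coefficients it equals
M a^2 + 2 p a S + (p - q) b2 + q S^2.

For the uniform law on a cube M = 27/7, p = 9/5, q = 1, and the infimum over S
of the terms without b2 is (27/7 - (9/5)^2) a^2 = (108/175) a^2, while
p - q = 4/5 exceeds 108/175; so the cube is asymptotically extremal.  In general
four facts replace these values.
- q >= 1 - O(1/N) ([moment_q_ge]): take expectations in
  r^3 >= 3 N^2 r - 2 N^3 for r = |x|^2, whose mean is N.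
- p >= (9/5) q ([moment_cross]) and E[x_0^2 (a x_0^2 + t sum_j x_j^2)^2] >=
  (108/175) a^2 ([Rintegral_head_form]).  Both hold because, given the other
  coordinates, the density is even and nonincreasing in |x_0|, that is, a
  mixture of uniform densities on intervals [-s, s]: an inequality linear in
  the conditional law has to be checked on these intervals only
  ([unimodal_expectation]).
- M is at most an absolute constant ([moment_sixth]).  This is where
  log-concavity is used beyond monotonicity: by the Prekopa-Leindler inequality
  ([prekopa_leindler]) the density of x_0 is log-concave too, and a log-concave
  even density of variance 1 has bounded sixth moment.

Given these, [quadratic_form_bound] compares the form with
(108/175 - O(1/N)) (a^2 + b2): if |S| is at most a constant times |a|, moving S
to equal coefficients costs only S^2/N; otherwise q S^2 dominates.

The convex potential of the density is tied to the measure only almost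
everywhere, so it need not be even itself.  Replacing it by its maximum with
its reflections changes it on a null set and keeps it convex
([even_log_density]); an even convex potential is nondecreasing in every |x_i|. *)

Set Implicit Arguments.
Unset Strict Implicit.
Unset Printing Implicit Defensive.

Import Order.TTheory GRing.Theory Num.Theory.
Import numFieldNormedType.Exports.

Local Open Scope classical_set_scope.
Local Open Scope ring_scope.

(** * Integration against Lebesgue measure on tuples *)

Section lebesgue_tuple_integral.
Variable R : realType.
Local Open Scope ereal_scope.

Lemma integral_lebesgue_tupleS n (G : n.+1.-tuple R -> \bar R) :
  measurable_fun setT G -> (forall x, 0 <= G x) ->
  \int[lebesgue_tuple R n.+1]_x G x =
  \int[@lebesgue_measure R]_a \int[lebesgue_tuple R n]_v G (tcons (a, v)).
Proof.
move=> mG G0.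
rewrite (@ge0_integral_pushforward _ _ _ _ R _ (@measurable_tcons R n)
  (@lebesgue_measure R \x lebesgue_tuple R n)) //=.
rewrite preimage_setT fubini_tonelli1//.
exact: measurableT_comp mG (@measurable_tcons R n).
Qed.

Lemma integral_lebesgue_tupleS_swap n (G : n.+1.-tuple R -> \bar R) :
  measurable_fun setT G -> (forall x, 0 <= G x) ->
  \int[lebesgue_tuple R n.+1]_x G x =
  \int[lebesgue_tuple R n]_v \int[@lebesgue_measure R]_a G (tcons (a, v)).
Proof.
move=> mG G0; rewrite integral_lebesgue_tupleS//.
apply: (fubini_tonelli (fun z => G (tcons z))) => //.
exact: measurableT_comp mG (@measurable_tcons R n).
Qed.

End lebesgue_tuple_integral.

Section reflections.
Variable R : realType.
Local Open Scope ereal_scope.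

Lemma integral_oppr (G : R -> \bar R) :
  measurable_fun setT G -> (forall x, 0 <= G x) ->
  \int[@lebesgue_measure R]_a G (- a)%R = \int[@lebesgue_measure R]_a G a.
Proof.
move=> mG G0; have mN : measurable_fun setT (-%R : measurableTypeR R -> measurableTypeR R).
  exact: oppr_measurable.
have := ge0_integral_pushforward mN (@lebesgue_measure R) measurableT mG.
rewrite preimage_setT => <-//.
by apply: eq_measure_integral => //= A mA _; exact: lebesgue_measureN.
Qed.

Lemma measurable_reflect_coord n (i : 'I_n) :
  measurable_fun setT (@reflect_coord R n i).
Proof.
apply/measurable_fun_tnthP => j /=.
rewrite (_ : _ \o _ = fun x : n.-tuple R =>
  if j == i then - tnth x j else tnth x j)%R; last first.
  by apply/funext => x /=; rewrite tnth_mktuple.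
case: eqP => _; last exact: measurable_tnth.
by apply: measurableT_comp => //; exact: measurable_tnth.
Qed.

Lemma measurable_permute n (s : {perm 'I_n}) :
  measurable_fun setT (@permute R n s).
Proof.
apply/measurable_fun_tnthP => j /=.
rewrite (_ : _ \o _ = (@tnth n R)^~ (s j)); first exact: measurable_tnth.
by apply/funext => x /=; rewrite tnth_mktuple.
Qed.

Lemma tnth_tcons0 n a (v : n.-tuple R) : tnth (tcons (a, v)) ord0 = a.
Proof. by []. Qed.

Lemma tnth_tconsS n a (v : n.-tuple R) i :
  tnth (tcons (a, v)) (lift ord0 i) = tnth v i.
Proof. by rewrite /tcons tnthS. Qed.

Lemma reflect_coord0_tcons n a (v : n.-tuple R) :
  reflect_coord ord0 (tcons (a, v)) = tcons ((- a)%R, v).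
Proof.
apply: eq_from_tnth => j; rewrite tnth_mktuple.
by have [k ->|->] := unliftP ord0 j; rewrite ?tnth_tconsS.
Qed.

Lemma reflect_coordS_tcons n i a (v : n.-tuple R) :
  reflect_coord (lift ord0 i) (tcons (a, v)) = tcons (a, reflect_coord i v).
Proof.
apply: eq_from_tnth => j; rewrite tnth_mktuple.
have [k ->|->] := unliftP ord0 j; rewrite ?tnth_tconsS//.
by rewrite (inj_eq lift_inj) tnth_mktuple.
Qed.

(** Induction on the dimension: the reflected coordinate is either the head, where
Lebesgue measure on the line is even, or it lies in the tail. *)
Lemma integral_reflect_coord n (i : 'I_n) (G : n.-tuple R -> \bar R) :
  measurable_fun setT G -> (forall x, 0 <= G x) ->
  \int[lebesgue_tuple R n]_x G (reflect_coord i x) =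
  \int[lebesgue_tuple R n]_x G x.
Proof.
elim: n i G => [[]//|n IH] i G mG G0.
have mGr : measurable_fun setT (fun x => G (reflect_coord i x)).
  exact: measurableT_comp mG (@measurable_reflect_coord n.+1 i).
rewrite !integral_lebesgue_tupleS//.
have mGt : measurable_fun setT (fun z => G (tcons z)).
  exact: measurableT_comp mG (@measurable_tcons R n).
have [k ->|->] := unliftP ord0 i.
  apply: eq_integral => a _.
  under eq_integral do rewrite reflect_coordS_tcons.
  apply: (IH k (fun v => G (tcons (a, v)))) => //.
  exact: (measurableT_comp mGt (measurable_pair1 a)).
under eq_integral do under eq_integral do rewrite reflect_coord0_tcons.
apply: (integral_oppr (G := fun a => \int[lebesgue_tuple R n]_v G (tcons (a, v)))).
  exact: (measurable_fun_fubini_tonelli_F (fun z => G (tcons z))).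
by move=> a; exact: integral_ge0.
Qed.

End reflections.

Section symmetrization.
Variables (R : realType) (n : nat).
Implicit Types (x y : n.-tuple R) (phi : n.-tuple R -> \bar R).
Implicit Type eta : probability (n.-tuple R) R.
Local Open Scope ereal_scope.

Lemma reflect_coordK (i : 'I_n) : involutive (@reflect_coord R n i).
Proof.
move=> x; apply: eq_from_tnth => j; rewrite !tnth_mktuple.
by case: eqP => // _; rewrite opprK.
Qed.

Lemma reflect_coordC (i j : 'I_n) x :
  reflect_coord i (reflect_coord j x) = reflect_coord j (reflect_coord i x).
Proof.
apply: eq_from_tnth => k; rewrite !tnth_mktuple.
by case: eqP => // _; case: eqP.
Qed.

Lemma reflect_coord_tconv (i : 'I_n) t x y :
  reflect_coord i (tconv t x y) = tconv t (reflect_coord i x) (reflect_coord i y).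
Proof.
apply: eq_from_tnth => k; rewrite !tnth_mktuple.
by case: eqP => // _; rewrite opprD !mulrN.
Qed.

(** Real-valued version of expeR (- phi), equal to it wherever phi is not -oo. *)
Definition exp_opp phi x : R :=
  if phi x == +oo then 0%R else expR (- fine (phi x)).

Lemma expeRN_exp_opp phi x : phi x != -oo ->
  expeR (- phi x) = (exp_opp phi x)%:E.
Proof. by rewrite /exp_opp; case: (phi x). Qed.

Lemma exp_opp_ge0 phi x : (0 <= exp_opp phi x)%R.
Proof. by rewrite /exp_opp; case: ifP => // _; exact: expR_ge0. Qed.

Lemma measurable_exp_opp phi : measurable_fun setT phi ->
  measurable_fun setT (exp_opp phi).
Proof.
move=> mphi; apply: measurable_fun_ifT => //=.
  exact: measurable_fun_eqe.
apply: measurableT_comp; first exact: measurable_expR.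
apply: measurableT_comp => //.
exact: measurableT_comp.
Qed.

Lemma measurable_expeRN phi : (forall x, phi x != -oo) ->
  measurable_fun setT phi -> measurable_fun setT (fun x => expeR (- phi x)).
Proof.
move=> phiNy mphi.
rewrite (_ : (fun _ => _) = EFin \o exp_opp phi); last first.
  by apply/funext => x; rewrite expeRN_exp_opp.
by apply/measurable_EFinP; exact: measurable_exp_opp.
Qed.

End symmetrization.

(** * An everywhere even log-concave density *)

Section even_density.
Variables (R : realType) (n : nat).
Implicit Types (x y : n.-tuple R) (phi : n.-tuple R -> \bar R).
Implicit Type eta : probability (n.-tuple R) R.
Local Open Scope ereal_scope.

Definition log_density eta phi :=
  [/\ econvex phi, measurable_fun setT phi &
      forall A, measurable A ->
        eta A = \int[lebesgue_tuple R n]_(x in A) expeR (- phi x)].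

Lemma econvex_reflect phi i : econvex phi ->
  econvex (fun x => phi (reflect_coord i x)).
Proof.
move=> [phiNy cphi]; split=> [x|t x y t01]; first exact: phiNy.
by rewrite reflect_coord_tconv; exact: cphi.
Qed.

Lemma econvex_max phi1 phi2 : econvex phi1 -> econvex phi2 ->
  econvex (fun x => maxe (phi1 x) (phi2 x)).
Proof.
move=> [p1 c1] [p2 c2]; split=> [x|t x y /andP[t0 t1]].
  by rewrite /maxe; case: ifP.
have t1' : 0 <= (1 - t)%:E by rewrite lee_fin subr_ge0.
have t0' : 0 <= t%:E by rewrite lee_fin.
rewrite ge_max; apply/andP; split.
- apply: (le_trans (c1 t x y _)); first by rewrite t0 t1.
  by apply: leeD; apply: lee_wpmul2l => //; rewrite le_max lexx.
- apply: (le_trans (c2 t x y _)); first by rewrite t0 t1.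
  by apply: leeD; apply: lee_wpmul2l => //; rewrite le_max lexx orbT.
Qed.

Lemma log_density_reflect eta phi i :
  invariant_under (reflect_coord i) eta -> log_density eta phi ->
  log_density eta (fun x => phi (reflect_coord i x)).
Proof.
move=> inv [cphi mphi dphi]; have mr := @measurable_reflect_coord R n i.
split; [exact: econvex_reflect|exact: measurableT_comp|].
move=> A mA; rewrite -(inv A mA) /pushforward.
have mrA : measurable (reflect_coord i @^-1` A).
  by rewrite -[X in measurable X]setTI; exact: mr.
have phiNy x : phi x != -oo by case: cphi.
transitivity (\int[lebesgue_tuple R n]_(x in reflect_coord i @^-1` A) expeR (- phi x)).
  exact: dphi.
rewrite integral_mkcond [RHS]integral_mkcond.
rewrite -(integral_reflect_coord i); last 2 first.
- apply: (measurable_restrictT _ _).1 => //; apply/measurable_funTS.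
  exact: measurable_expeRN.
- by move=> x; apply: erestrict_ge0 => y _; exact: expeR_ge0.
apply: eq_integral => x _; rewrite !patchE; congr (if _ then _ else _).
by apply/idP/idP; rewrite !inE /= reflect_coordK.
Qed.

Lemma log_density_ae_unique eta phi psi :
  log_density eta phi -> log_density eta psi ->
  {ae lebesgue_tuple R n, forall x, expeR (- phi x) = expeR (- psi x)}.
Proof.
move=> [[phiNy _] mphi dphi] [[psiNy _] mpsi dpsi].
have : ae_eq (lebesgue_tuple R n) setT
    (fun x => expeR (- phi x)) (fun x => expeR (- psi x)).
  apply: integral_ae_eq => //; last 2 first.
  - exact: measurable_expeRN.
  - by move=> E _ mE'; rewrite -dphi// -dpsi.
  apply/integrableP; split; first exact: measurable_expeRN.
  under eq_integral do rewrite gee0_abs ?expeR_ge0//.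
  by rewrite -dphi// probability_setT ltry.
by apply: filterS => x /(_ I).
Qed.

(** Two log-densities of the same measure agree almost everywhere, so their maximum
is a third one; unlike the density itself, a maximum stays convex. *)
Lemma log_density_max eta phi psi :
  log_density eta phi -> log_density eta psi ->
  log_density eta (fun x => maxe (phi x) (psi x)).
Proof.
move=> dphi dpsi; have ae := log_density_ae_unique dphi dpsi.
case: dphi => cphi mphi dphi; case: dpsi => cpsi mpsi dpsi.
have mmax : measurable_fun setT (fun x => maxe (phi x) (psi x)).
  exact: measurable_maxe.
have cmax := econvex_max cphi cpsi.
split => // A mA; rewrite dphi//.
apply: ge0_ae_eq_integral => //.
- by apply: measurable_funTS; apply: measurable_expeRN => //; case: cphi.
- apply: measurable_funTS.
  by apply: (measurable_expeRN (phi := fun x => maxe (phi x) (psi x))) => //; case: cmax.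
- by move=> x _; exact: expeR_ge0.
- by move=> x _; exact: expeR_ge0.
- apply: filterS ae => x phipsi _.
  by rewrite /maxe; case: ifP.
Qed.

(** Symmetrizes one coordinate at a time; reflections commute, so the evenness
already gained is preserved. *)
Lemma even_log_density eta : (forall i, invariant_under (reflect_coord i) eta) ->
  log_concave eta ->
  exists2 phi, log_density eta phi &
    forall i x, phi (reflect_coord i x) = phi x.
Proof.
move=> inv [phi0 [c0 m0 d0]].
suff [phi dphi ephi] : exists2 phi, log_density eta phi &
    forall i x, i \in enum 'I_n -> phi (reflect_coord i x) = phi x.
  by exists phi => // i x; rewrite ephi// mem_enum.
elim: (enum 'I_n) => [|i s [phi dphi ephi]]; first by exists phi0.
exists (fun x => maxe (phi x) (phi (reflect_coord i x))).
  by apply: log_density_max => //; exact: log_density_reflect.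
move=> j x; rewrite inE => /orP[/eqP->|js].
  by rewrite reflect_coordK maxC.
by rewrite reflect_coordC !(ephi j _ js).
Qed.

End even_density.

Section density.
Variables (R : realType) (n : nat).
Implicit Types (x y : n.-tuple R) (phi : n.-tuple R -> \bar R).
Implicit Type eta : probability (n.-tuple R) R.

(** One condition for evenness in each coordinate and monotonicity in each |x_i|, which
passes to sections and to truncations. *)
Definition coord_dec (F : n.-tuple R -> R) := forall x y,
  (forall i, `|tnth x i| <= `|tnth y i|) -> F y <= F x.

Definition midpoint x y : n.-tuple R :=
  [tuple (tnth x i + tnth y i) / 2 | i < n].

Definition density eta (F : n.-tuple R -> R) := forall A, measurable A ->
  eta A = (\int[lebesgue_tuple R n]_(x in A) (F x)%:E)%E.

(** With c = x_i / y_i in [-1, 1], the point x is the convex combination of y and of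
its reflection with weight (1 + c) / 2. *)
Lemma even_convex_one_coord phi x y i : econvex phi ->
  (forall j z, phi (reflect_coord j z) = phi z) ->
  (forall j, j != i -> tnth x j = tnth y j) ->
  `|tnth x i| <= `|tnth y i| -> (phi x <= phi y)%E.
Proof.
move=> [phiNy cphi] ephi xy xyi.
have [yi0|yi0] := eqVneq (tnth y i) 0.
  suff -> : x = y by [].
  apply: eq_from_tnth => j; have [->|/xy//] := eqVneq j i.
  by move: xyi; rewrite yi0 normr0 normr_le0 => /eqP.
have yi0' : 0 < `|tnth y i| by rewrite normr_gt0.
pose c := tnth x i / tnth y i.
have /andP[c1 c2] : -1 <= c <= 1.
  by rewrite -ler_norml normrM normfV ler_pdivrMr// mul1r.
pose t := (1 + c) / 2.
have t01 : 0 <= t <= 1 by rewrite /t; apply/andP; split; lra.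
have -> : x = tconv t y (reflect_coord i y).
  apply: eq_from_tnth => j; rewrite !tnth_mktuple.
  have [->|ji] := eqVneq j i; last by rewrite xy//; ring.
  rewrite mulrN -mulrBl.
  have -> : t - (1 - t) = c by rewrite /t; lra.
  by rewrite /c divfK.
apply: (le_trans (cphi _ _ _ t01)); rewrite ephi.
have /andP[t0 t1] := t01.
rewrite -ge0_muleDl ?lee_fin ?subr_ge0//.
by rewrite -EFinD addrCA subrr addr0 mul1e.
Qed.

(** Replaces the coordinates of y by those of x one after the other. *)
Lemma even_convex_le phi x y : econvex phi ->
  (forall j z, phi (reflect_coord j z) = phi z) ->
  (forall i, `|tnth x i| <= `|tnth y i|) -> (phi x <= phi y)%E.
Proof.
move=> cphi ephi xy.
pose z k : n.-tuple R := [tuple if (i < k)%N then tnth x i else tnth y i | i < n].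
have z0 : z 0%N = y by apply: eq_from_tnth => i; rewrite tnth_mktuple.
have zn : z n = x by apply: eq_from_tnth => i; rewrite tnth_mktuple ltn_ord.
suff H k : (k <= n)%N -> (phi (z k) <= phi y)%E by rewrite -zn; exact: H.
elim: k => [|k IH] kn; first by rewrite z0.
apply: (le_trans _ (IH (ltnW kn))).
apply: (@even_convex_one_coord _ _ _ (Ordinal kn)) => //.
  move=> j; rewrite -val_eqE /= => jk; rewrite !tnth_mktuple ltnS leq_eqVlt.
  by rewrite (negbTE jk).
by rewrite !tnth_mktuple /= ltnSn ltnn.
Qed.

Lemma midpoint_tconv x y : midpoint x y = tconv 2^-1 x y.
Proof. by apply: eq_from_tnth => i; rewrite !tnth_mktuple; field. Qed.

Lemma exp_opp_midpoint phi x y : econvex phi ->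
  exp_opp phi x * exp_opp phi y <= exp_opp phi (midpoint x y) ^+ 2.
Proof.
move=> [phiNy cphi]; rewrite {1 2}/exp_opp.
case: ifPn => px; first by rewrite mul0r sqr_ge0.
case: ifPn => py; first by rewrite mulr0 sqr_ge0.
have t01 : 0 <= (2^-1 : R) <= 1 by apply/andP; split; lra.
have := cphi 2^-1 x y t01; rewrite -midpoint_tconv.
have pfin z : phi z != +oo%E -> phi z = (fine (phi z))%:E.
  by move: (phiNy z); case: (phi z).
rewrite (pfin x)// (pfin y)// -!EFinM -EFinD /= => le.
have pm : phi (midpoint x y) != +oo%E.
  by apply/eqP => E; move: le; rewrite E leye_eq.
rewrite /exp_opp (negbTE pm) -expRD expr2 -expRD ler_expR.
by move: le; rewrite (pfin (midpoint x y))// lee_fin /=; lra.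
Qed.

Lemma even_density eta : (forall i, invariant_under (reflect_coord i) eta) ->
  log_concave eta ->
  exists F : n.-tuple R -> R, [/\ measurable_fun setT F, forall x, 0 <= F x, coord_dec F,
    forall x y, F x * F y <= F (midpoint x y) ^+ 2 & density eta F].
Proof.
move=> inv lc; have [phi [cphi mphi dphi] ephi] := even_log_density inv lc.
have phiNy x : phi x != -oo%E by case: cphi.
exists (exp_opp phi); split.
- exact: measurable_exp_opp.
- exact: exp_opp_ge0.
- move=> x y xy; rewrite -lee_fin -!expeRN_exp_opp// lee_expeR leeN2.
  exact: even_convex_le.
- by move=> x y; exact: exp_opp_midpoint.
- move=> A mA; rewrite dphi//; apply: eq_integral => x _.
  by rewrite expeRN_exp_opp.
Qed.

Local Open Scope ereal_scope.

(** F is a Radon-Nikodym derivative of eta, because derivatives are unique almost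
everywhere. *)
Lemma integral_density eta (F : n.-tuple R -> R) (g : n.-tuple R -> \bar R) :
  measurable_fun setT F -> (forall x, (0 <= F x)%R) -> density eta F ->
  measurable_fun setT g -> (forall x, 0 <= g x) ->
  \int[eta]_x g x = \int[lebesgue_tuple R n]_x (g x * (F x)%:E).
Proof.
move=> mF F0 dF mg g0.
have mEF : measurable_fun setT (fun x => (F x)%:E) by exact/measurable_EFinP.
have dom : eta `<< lebesgue_tuple R n.
  apply/null_content_dominatesP => A mA A0; rewrite dF//.
  by rewrite null_set_integral//; exact/measurable_funTS.
rewrite -(Radon_Nikodym_SigmaFinite.change_of_variables dom)//.
have iRN := Radon_Nikodym_SigmaFinite.f_integrable dom.
have mRN := measurable_int _ iRN.
have RN0 := Radon_Nikodym_SigmaFinite.f_ge0 dom.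
apply: ge0_ae_eq_integral => //.
- exact: emeasurable_funM.
- exact: emeasurable_funM.
- by move=> x _; rewrite mule_ge0.
- by move=> x _; rewrite mule_ge0// lee_fin.
have : ae_eq (lebesgue_tuple R n) setT
    (Radon_Nikodym_SigmaFinite.f eta (lebesgue_tuple R n)) (EFin \o F).
  apply: integral_ae_eq => // E _ mE.
  by rewrite -Radon_Nikodym_SigmaFinite.f_integral//; exact: dF.
by apply: filterS => x /(_ I) /= -> _.
Qed.

End density.

(** * Layer cake and unimodality on the line *)

Section layer_cake.
Context d (T : measurableType d) (R : realType).
Variable mu : {sigma_finite_measure set T -> \bar R}.
Local Open Scope ereal_scope.

Let layer (q : T -> R) (k : T -> \bar R) (z : T * measurableTypeR R) : \bar R :=
  if (0 <= z.2)%R && (z.2 < q z.1)%R then k z.1 else 0.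

Let measurable_layer q k : measurable_fun setT q -> measurable_fun setT k ->
  measurable_fun setT (layer q k).
Proof.
move=> mq mk; apply: measurable_fun_ifT => //=.
  apply: measurable_and.
    by apply: measurable_fun_ler => //; exact: measurable_snd.
  apply: measurable_fun_ltr; first exact: measurable_snd.
  by apply: measurableT_comp => //; exact: measurable_fst.
by apply: measurableT_comp => //; exact: measurable_fst.
Qed.

(** Fubini for the region {(x, t) : 0 <= t < q x}. *)
Lemma layer_cake (q : T -> R) (k : T -> \bar R) :
  measurable_fun setT q -> (forall x, 0 <= q x)%R ->
  measurable_fun setT k -> (forall x, 0 <= k x) ->
  \int[mu]_x ((q x)%:E * k x) =
  \int[@lebesgue_measure R]_(t in `[0%R, +oo[)
    \int[mu]_(x in [set x | t < q x]%R) k x.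
Proof.
move=> mq q0 mk k0.
have mlay := measurable_layer mq mk.
have l0 z : 0 <= layer q k z by rewrite /layer; case: ifP.
transitivity (\int[mu]_x \int[@lebesgue_measure R]_t layer q k (x, t)).
  apply: eq_integral => x _.
  transitivity (\int[@lebesgue_measure R]_(t in `[0%R, q x[) k x).
    by rewrite integral_cst//= lebesgue_measure_itv/= lte_fin;
      have [->|q0'] := eqVneq (q x) 0%R;
      [rewrite ltxx mule0 mul0e|rewrite lt_neqAle eq_sym q0' q0/= oppr0 adde0 muleC].
  rewrite integral_mkcond; apply: eq_integral => t _.
  rewrite patchE /layer /=; case: ifPn.
    by rewrite inE /= in_itv /= => ->.
  by rewrite notin_setE /= in_itv /= => /negP/negbTE ->.
rewrite (fubini_tonelli (layer q k))//=.
rewrite [RHS]integral_mkcond; apply: eq_integral => t _.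
rewrite patchE; case: ifPn; rewrite ?notin_setE ?inE /= in_itv /= andbT.
  move=> t0; rewrite [RHS]integral_mkcond; apply: eq_integral => x _.
  rewrite patchE /layer /= t0 /=; case: ifPn => tq; first by rewrite mem_set.
  by rewrite memNset// => /= tq'; rewrite tq' in tq.
move=> /negP/negbTE t0; rewrite /layer /= t0 /=.
by rewrite integral0.
Qed.

Lemma measurable_layer_integral (q : T -> R) (k : T -> \bar R) :
  measurable_fun setT q -> measurable_fun setT k -> (forall x, 0 <= k x) ->
  measurable_fun (`[0%R, +oo[%classic : set (measurableTypeR R))
    (fun t => \int[mu]_(x in [set x | t < q x]%R) k x).
Proof.
move=> mq mk k0; have mlay := measurable_layer mq mk.
have l0 z : 0 <= layer q k z by rewrite /layer; case: ifP.
apply: (eq_measurable_fun (fun t => \int[mu]_x layer q k (x, t))); last first.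
  apply: measurable_funTS.
  exact: (measurable_fun_fubini_tonelli_G (layer q k)).
move=> t; rewrite inE /= in_itv /= andbT => t0.
rewrite [RHS]integral_mkcond; apply: eq_integral => x _.
rewrite patchE /layer /= t0 /=; case: ifPn => tq; first by rewrite mem_set.
by rewrite memNset// => /= tq'; rewrite tq' in tq.
Qed.

End layer_cake.

Section balanced.
Variable R : realType.
Implicit Types (S : set R) (q : R -> R) (k : R -> \bar R).

Definition balanced S := forall x y : R, `|x| <= `|y| -> S y -> S x.

(** A balanced subset of the line is a symmetric interval, open or closed. *)
Lemma balanced_bounded S : balanced S -> S !=set0 -> has_ubound S ->
  [/\ 0 <= sup S, forall x, `|x| < sup S -> S x & forall x, S x -> `|x| <= sup S].
Proof.
move=> bS S0 ubS.
have SN x : S x -> `|x| <= sup S.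
  move=> Sx; apply: ub_le_sup => //.
  by apply: bS Sx; rewrite normr_id.
split => //.
- by case: S0 => x /SN; apply: le_trans.
- move=> x xS.
  have [||y Sy xy] := @sup_adherent _ S (sup S - `|x|).
  + by rewrite subr_gt0.
  + by split.
  apply: bS Sy; move: xy; rewrite opprB addrC subrK => /ltW xy.
  exact: le_trans xy (ler_norm y).
Qed.

Lemma balanced_unbounded S : balanced S -> ~ has_ubound S -> S = setT.
Proof.
move=> bS uS; apply/seteqP; split => // x _; apply: contrapT => Sx.
apply: uS; exists `|x| => y Sy; rewrite leNgt; apply/negP => xy.
by apply: Sx; apply: bS Sy; rewrite (le_trans (ltW xy))// ler_norm.
Qed.

Local Notation mu := (@lebesgue_measure R).
Local Open Scope ereal_scope.

(** The endpoints of a symmetric interval are negligible; if S is the whole line,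
exhaust it by the intervals [-i, i]. *)
Lemma balanced_integral_le S k1 k2 : balanced S -> measurable S ->
  measurable_fun setT k1 -> (forall x, 0 <= k1 x) ->
  measurable_fun setT k2 -> (forall x, 0 <= k2 x) ->
  (forall s : R, (0 <= s)%R -> (forall y, (`|y| < s)%R -> S y) ->
    \int[mu]_(x in `[(- s)%R, s]) k1 x <= \int[mu]_(x in `[(- s)%R, s]) k2 x) ->
  \int[mu]_(x in S) k1 x <= \int[mu]_(x in S) k2 x.
Proof.
move=> bS mS mk1 k10 mk2 k20 k12.
have [S0|/set0P/negP] := pselect (S !=set0); last first.
  by rewrite negbK => /eqP ->; rewrite !integral_set0.
have [ubS|nubS] := pselect (has_ubound S).
  have [s0 sS Ss] := balanced_bounded bS S0 ubS.
  apply: (@le_trans _ _ (\int[mu]_(x in `[(- sup S)%R, sup S]) k1 x)).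
    apply: ge0_subset_integral => //; first exact: measurable_funTS.
    by move=> x /Ss; rewrite /= in_itv /= -ler_norml.
  apply: (le_trans (k12 _ s0 sS)).
  rewrite integral_itv_bndoo; last exact: measurable_funTS.
  apply: ge0_subset_integral => //; first exact: measurable_funTS.
  by move=> x; rewrite /= in_itv /= -ltr_norml => /sS.
have ST := balanced_unbounded bS nubS.
pose B (i : nat) : set R := `[(- i%:R)%R, i%:R]%classic.
have UB : \bigcup_i B i = S.
  rewrite ST; apply/seteqP; split => // x _.
  exists (Num.trunc `|x|).+1 => //; rewrite /B /= in_itv /= -ler_norml.
  by rewrite ltW// truncnS_gt.
have ndB : nondecreasing_seq B.
  move=> i j ij; rewrite subsetEset => x; rewrite /B /= !in_itv /= -!ler_norml.
  by move/le_trans; apply; rewrite ler_nat.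
rewrite -UB.
have cvg1 := ge0_nondecreasing_set_cvg_integral (mu := mu) ndB
  (fun i => measurable_itv _) (fun i => measurable_funTS mk1) (fun i x _ => k10 x).
rewrite -(cvg_lim _ cvg1)//; apply: lime_le.
  by apply/cvg_ex; eexists; exact: cvg1.
apply: nearW => i; apply: (@le_trans _ _ (\int[mu]_(x in B i) k2 x)).
  by apply: k12 => // y _; rewrite ST.
rewrite UB; apply: ge0_subset_integral => //.
- exact: measurable_itv.
- exact: measurable_funTS.
- by rewrite ST.
Qed.

(** An even function q nonincreasing in |x| is a mixture of indicators of symmetric
intervals, namely of its superlevel sets, so a comparison on all intervals [-s, s]
passes to the weight q.  Only the intervals on which q is positive occur. *)
Lemma unimodal_integral_le q k1 k2 :
  measurable_fun setT q -> (forall x, 0 <= q x)%R ->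
  (forall x y, `|x| <= `|y| -> q y <= q x)%R ->
  measurable_fun setT k1 -> (forall x, 0 <= k1 x) ->
  measurable_fun setT k2 -> (forall x, 0 <= k2 x) ->
  (forall s : R, (0 <= s)%R -> (forall y, `|y| < s -> 0 < q y)%R ->
    \int[mu]_(x in `[(- s)%R, s]) k1 x <= \int[mu]_(x in `[(- s)%R, s]) k2 x) ->
  \int[mu]_x ((q x)%:E * k1 x) <= \int[mu]_x ((q x)%:E * k2 x).
Proof.
move=> mq q0 dq mk1 k10 mk2 k20 k12.
rewrite (layer_cake mu mq)// (layer_cake mu mq)//.
apply: ge0_le_integral => //=.
- by move=> t _; exact: integral_ge0.
- exact: measurable_layer_integral.
- exact: measurable_layer_integral.
move=> t; rewrite in_itv /= andbT => t0.
apply: balanced_integral_le => //.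
- by move=> x y xy /= tq; exact: lt_le_trans tq (dq _ _ xy).
- rewrite -[X in measurable X]setTI -preimage_itvoy.
  exact: mq.
- move=> s s0 sq; apply: k12 => // y ys.
  by rewrite (le_lt_trans t0)//; exact: sq.
Qed.

End balanced.

(** * A Prekopa-Leindler inequality for unconditional functions *)

Section prekopa_leindler_line.
Variable R : realType.
Local Notation mu := (@lebesgue_measure R).

Lemma le_lebesgue_balanced (r : R) (S : set R) : measurable S -> 0 <= r ->
  (forall x, S x -> `|x| <= r) -> (mu S <= (r + r)%:E)%E.
Proof.
move=> mS r0 Sr; apply: (@le_trans _ _ (mu `[- r, r])).
  apply: le_measure; rewrite ?inE//.
  by move=> x /Sr; rewrite /= in_itv /= ler_norml.
rewrite lebesgue_measure_itv /= lte_fin; case: ifP => // _.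
  by rewrite -EFinD opprK.
by rewrite lee_fin addr_ge0.
Qed.

Lemma ge_lebesgue_balanced (r : R) (S : set R) : measurable S -> 0 <= r ->
  (forall x, `|x| < r -> S x) -> ((r + r)%:E <= mu S)%E.
Proof.
move=> mS r0 Sr; apply: (@le_trans _ _ (mu `]- r, r[)); last first.
  apply: le_measure; rewrite ?inE//.
  by move=> x; rewrite /= in_itv /= -ltr_norml; exact: Sr.
rewrite lebesgue_measure_itv /= lte_fin; case: ifPn => [_|].
  by rewrite -EFinD opprK.
by rewrite -leNgt lee_fin; lra.
Qed.

Definition even_dec (f : R -> R) := forall x y, `|x| <= `|y| -> f y <= f x.

Let measurable_sup (f : R -> R) (t : R) : measurable_fun setT f ->
  measurable [set x | t < f x].
Proof.
by move=> mf; rewrite -[X in measurable X]setTI -preimage_itvoy; exact: mf.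
Qed.

(** In dimension one the superlevel sets of f and g are symmetric intervals, and
the midpoints of their points lie in the superlevel set of h: a trivial case of the
Brunn-Minkowski inequality. *)
Lemma superlevel_sum (f g h : R -> R) (T t : R) : 0 <= t ->
  measurable_fun setT f -> measurable_fun setT g -> measurable_fun setT h ->
  even_dec f -> even_dec g -> (forall x, 0 <= h x) ->
  (forall x, T < `|x| -> f x = 0) -> (forall x, T < `|x| -> g x = 0) ->
  f 0 = 1 -> g 0 = 1 ->
  (forall x y, f x * g y <= h ((x + y) / 2) ^+ 2) ->
  (mu [set x | (t < f x)%R] + mu [set x | (t < g x)%R] <=
   mu [set x | (t < h x)%R] + mu [set x | (t < h x)%R])%E.
Proof.
move=> t0 mf mg mh df dg h0 f_T g_T f01 g01 fgh.
have empty (u : R -> R) : even_dec u -> u 0 = 1 -> 1 <= t ->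
    [set x | t < u x] = set0.
  move=> du u01 t1; apply/seteqP; split => // x /=.
  rewrite ltNge => /negP; apply; apply: le_trans t1.
  by rewrite -u01; apply: du; rewrite normr0.
have [t1|t1] := leP 1 t.
  by rewrite (empty f)// (empty g)// measure0 adde0 adde_ge0.
have bal (u : R -> R) : even_dec u -> balanced [set x | t < u x].
  by move=> du x y xy /= tu; exact: lt_le_trans tu (du _ _ xy).
have ubd (u : R -> R) : (forall x, T < `|x| -> u x = 0) ->
    has_ubound [set x | t < u x].
  move=> uT; exists T => x /= tux; rewrite leNgt; apply/negP => Tx.
  by move: tux; rewrite uT ?(lt_le_trans Tx)// ?ler_norm// ltNge t0.
have [rf0 fr Fr] : [/\ 0 <= sup [set x | t < f x],
    forall x, `|x| < sup [set x | t < f x] -> t < f x &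
    forall x, t < f x -> `|x| <= sup [set x | t < f x]].
  by apply: balanced_bounded; [exact: bal|exists 0; rewrite /= f01|exact: ubd].
have [rg0 gr Gr] : [/\ 0 <= sup [set x | t < g x],
    forall x, `|x| < sup [set x | t < g x] -> t < g x &
    forall x, t < g x -> `|x| <= sup [set x | t < g x]].
  by apply: balanced_bounded; [exact: bal|exists 0; rewrite /= g01|exact: ubd].
set rf := sup _ in rf0 fr Fr; set rg := sup _ in rg0 gr Gr.
apply: (@le_trans _ _ ((rf + rf)%:E + (rg + rg)%:E)%E).
  by apply: leeD; apply: le_lebesgue_balanced => //; exact: measurable_sup.
have hr : ((rf + rg) / 2 + (rf + rg) / 2)%:E%E = (rf + rg)%:E%E.
  by congr EFin; field.
suff mhr : ((rf + rg)%:E <= mu [set x | (t < h x)%R])%E.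
  apply: le_trans (leeD mhr mhr); rewrite -!EFinD lee_fin; lra.
rewrite -hr; apply: ge_lebesgue_balanced; first exact: measurable_sup.
  by rewrite divr_ge0// addr_ge0.
move=> y yr.
have r_gt0 : 0 < rf + rg.
  have := le_lt_trans (normr_ge0 y) yr; lra.
(* the point y is the midpoint of the two points below it in proportion *)
pose c := 2 * y / (rf + rg).
have c1 : `|c| < 1.
  rewrite /c normrM normfV (gtr0_norm r_gt0) ltr_pdivrMr// mul1r.
  rewrite normrM ger0_norm//; lra.
have scale (u : R -> R) r : 0 <= r -> u 0 = 1 -> (forall x, `|x| < r -> t < u x) ->
    t < u (c * r).
  move=> r0 u01 ur; have [->|rn0] := eqVneq r 0; first by rewrite mulr0 u01.
  apply: ur; rewrite normrM (ger0_norm r0) gtr_pMl//.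
  by rewrite lt_neqAle eq_sym rn0.
have fa := scale f _ rf0 f01 fr; have gb := scale g _ rg0 g01 gr.
have yE : (c * rf + c * rg) / 2 = y.
  rewrite -mulrDr /c; field; lra.
have := fgh (c * rf) (c * rg); rewrite yE => le.
rewrite /= ltNge; apply/negP => hy.
have : h y ^+ 2 <= t ^+ 2 by rewrite ler_pXn2r// ?nnegrE.
nra.
Qed.

(** Integrates the comparison of superlevel sets over the levels.  Dividing by the
maxima first makes the levels of f, g and h correspond. *)
Lemma prekopa_leindler_normalized (f g h : R -> R) (T : R) :
  measurable_fun setT f -> measurable_fun setT g -> measurable_fun setT h ->
  (forall x, 0 <= f x) -> (forall x, 0 <= g x) -> (forall x, 0 <= h x) ->
  even_dec f -> even_dec g ->
  (forall x, T < `|x| -> f x = 0) -> (forall x, T < `|x| -> g x = 0) ->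
  f 0 = 1 -> g 0 = 1 ->
  (forall x y, f x * g y <= h ((x + y) / 2) ^+ 2) ->
  (\int[mu]_x (f x)%:E + \int[mu]_x (g x)%:E <=
   \int[mu]_x (h x)%:E + \int[mu]_x (h x)%:E)%E.
Proof.
move=> mf mg mh f0 g0 h0 df dg f_T g_T f01 g01 fgh.
have lc (u : R -> R) : measurable_fun setT u -> (forall x, 0 <= u x) ->
    (\int[mu]_x (u x)%:E = \int[mu]_(t in `[0%R, +oo[) mu [set x | (t < u x)%R])%E.
  move=> mu_ u0; transitivity (\int[mu]_x ((u x)%:E * (cst 1 x)))%E.
    by apply: eq_integral => x _; rewrite mule1.
  rewrite (layer_cake mu mu_)//; apply: eq_integral => t _.
  by rewrite integral_cst ?mul1e//; exact: measurable_sup.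
have mlev (u : R -> R) : measurable_fun setT u ->
    measurable_fun (`[0%R, +oo[%classic : set (measurableTypeR R))
      (fun t => mu [set x | (t < u x)%R]).
  move=> mu_.
  have := measurable_layer_integral mu mu_ (measurable_cst 1%E) (fun=> lee01).
  apply: eq_measurable_fun => t _.
  by rewrite integral_cst ?mul1e//; exact: measurable_sup.
rewrite !lc// -!ge0_integralD//; try exact: mlev.
apply: ge0_le_integral => //=.
- by move=> t _; rewrite adde_ge0.
- by apply: emeasurable_funD; exact: mlev.
- by apply: emeasurable_funD; exact: mlev.
move=> t; rewrite in_itv /= andbT => t0.
exact: (@superlevel_sum f g h T).
Qed.

(** Divide f and g by their values at 0, and h by the geometric mean of these
values; the arithmetic-geometric mean inequality turns the additive conclusion of the
normalized case into the multiplicative one. *)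
Lemma prekopa_leindler_line (f g h : R -> R) (T a b c : R) :
  measurable_fun setT f -> measurable_fun setT g -> measurable_fun setT h ->
  (forall x, 0 <= f x) -> (forall x, 0 <= g x) -> (forall x, 0 <= h x) ->
  even_dec f -> even_dec g ->
  (forall x, T < `|x| -> f x = 0) -> (forall x, T < `|x| -> g x = 0) ->
  (forall x y, f x * g y <= h ((x + y) / 2) ^+ 2) ->
  (\int[mu]_x (f x)%:E = a%:E)%E -> (\int[mu]_x (g x)%:E = b%:E)%E ->
  (\int[mu]_x (h x)%:E = c%:E)%E ->
  a * b <= c ^+ 2.
Proof.
move=> mf mg mh f0 g0 h0 df dg f_T g_T fgh fa gb hc.
have zero (u : R -> R) r : (forall x, 0 <= u x) -> even_dec u ->
    (\int[mu]_x (u x)%:E = r%:E)%E -> u 0 = 0 -> r = 0.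
  move=> u0 du ur u00; have : (\int[mu]_x (u x)%:E = 0)%E.
    apply: integral0_eq => x _; congr EFin; apply/eqP; rewrite eq_le u0 andbT.
    by rewrite -u00 du// normr0.
  by rewrite ur => -[].
have [A0|A0] := eqVneq (f 0) 0.
  by rewrite (zero f a)// mul0r sqr_ge0.
have [B0|B0] := eqVneq (g 0) 0.
  by rewrite (zero g b)// mulr0 sqr_ge0.
have Apos : 0 < f 0 by rewrite lt_neqAle eq_sym A0 f0.
have Bpos : 0 < g 0 by rewrite lt_neqAle eq_sym B0 g0.
set A := f 0 in A0 Apos; set B := g 0 in B0 Bpos.
pose C := Num.sqrt (A * B).
have Cpos : 0 < C by rewrite sqrtr_gt0 mulr_gt0.
have C2 : C ^+ 2 = A * B by rewrite sqr_sqrtr// mulr_ge0// ltW.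
have scale (u : R -> R) r k : 0 < k -> measurable_fun setT u ->
    (forall x, 0 <= u x) -> (\int[mu]_x (u x)%:E = r%:E)%E ->
    (\int[mu]_x (k^-1 * u x)%:E = (k^-1 * r)%:E)%E.
  move=> k0 mu_ u0 ur; under eq_integral do rewrite EFinM.
  rewrite ge0_integralZl_EFin ?ur//.
  - by move=> x _; rewrite lee_fin.
  - exact/measurable_EFinP.
  - by rewrite invr_ge0 ltW.
have : (\int[mu]_x (A^-1 * f x)%:E + \int[mu]_x (B^-1 * g x)%:E <=
    \int[mu]_x (C^-1 * h x)%:E + \int[mu]_x (C^-1 * h x)%:E)%E.
  apply: (@prekopa_leindler_normalized (fun x => A^-1 * f x) (fun x => B^-1 * g x)
    (fun x => C^-1 * h x) T).
  - exact: measurable_funM.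
  - exact: measurable_funM.
  - exact: measurable_funM.
  - by move=> x; rewrite mulr_ge0// invr_ge0 ltW.
  - by move=> x; rewrite mulr_ge0// invr_ge0 ltW.
  - by move=> x; rewrite mulr_ge0// invr_ge0 ltW.
  - by move=> x y xy; rewrite ler_pM2l ?invr_gt0//; exact: df.
  - by move=> x y xy; rewrite ler_pM2l ?invr_gt0//; exact: dg.
  - by move=> x /f_T ->; rewrite mulr0.
  - by move=> x /g_T ->; rewrite mulr0.
  - by rewrite mulVf.
  - by rewrite mulVf.
  - move=> x y; rewrite exprMn exprVn C2 mulrACA -invfM.
    by rewrite ler_pM2l ?invr_gt0 ?mulr_gt0.
rewrite (scale f a A)// (scale g b B)// (scale h c C)// -!EFinD lee_fin => le.
have a0 : 0 <= a by rewrite -lee_fin -fa; apply: integral_ge0 => x _; rewrite lee_fin.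
have b0 : 0 <= b by rewrite -lee_fin -gb; apply: integral_ge0 => x _; rewrite lee_fin.
have c0 : 0 <= c by rewrite -lee_fin -hc; apply: integral_ge0 => x _; rewrite lee_fin.
pose a' := A^-1 * a; pose b' := B^-1 * b; pose c' := C^-1 * c.
have a'0 : 0 <= a' by rewrite mulr_ge0// invr_ge0 ltW.
have b'0 : 0 <= b' by rewrite mulr_ge0// invr_ge0 ltW.
have c'0 : 0 <= c' by rewrite mulr_ge0// invr_ge0 ltW.
have -> : a * b = C ^+ 2 * (a' * b').
  by rewrite C2 /a' /b'; field; rewrite A0 B0.
have -> : c ^+ 2 = C ^+ 2 * c' ^+ 2.
  by rewrite /c'; field; rewrite gt_eqF.
rewrite ler_pM2l ?exprn_gt0//.
rewrite -/a' -/b' -/c' in le.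
have := sqr_ge0 (a' - b'); nra.
Qed.

End prekopa_leindler_line.

Section prekopa_leindler.
Variable R : realType.
Local Notation mu := (@lebesgue_measure R).

(** Boundedness and bounded support keep all partial integrals finite, so that
the induction on the dimension stays within real-valued functions. *)
Definition tame n (M T : R) (F : n.-tuple R -> R) :=
  [/\ measurable_fun setT F, forall x, 0 <= F x <= M, coord_dec F &
      forall x i, T < `|tnth x i| -> F x = 0].

Lemma midpoint_tcons n a b (v w : n.-tuple R) :
  midpoint (tcons (a, v)) (tcons (b, w)) = tcons ((a + b) / 2, midpoint v w).
Proof.
apply: eq_from_tnth => i; rewrite tnth_mktuple.
by have [j ->|->] := unliftP ord0 i; rewrite ?tnth_tconsS ?tnth_mktuple.
Qed.

Lemma tame_slice n M T (F : n.+1.-tuple R -> R) a : tame M T F ->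
  tame M T (fun v => F (tcons (a, v))).
Proof.
move=> [mF F0M dF FT]; split.
- have mFt : measurable_fun setT (fun z => F (tcons z)).
    exact: measurableT_comp mF (@measurable_tcons R n).
  exact: (measurableT_comp mFt (measurable_pair1 a)).
- by move=> v; exact: F0M.
- move=> v w vw; apply: dF => i.
  by have [j ->|->] := unliftP ord0 i; rewrite ?tnth_tconsS.
- by move=> v i Tv; apply: (FT _ (lift ord0 i)); rewrite tnth_tconsS.
Qed.

Lemma tame_integral_bound n M T : 0 <= M -> exists2 M' : R, 0 <= M' &
  forall F : n.-tuple R -> R, tame M T F ->
    (\int[lebesgue_tuple R n]_x (F x)%:E <= M'%:E)%E.
Proof.
move=> M0; elim: n => [|n [M' M'0 IH]].
  exists M => // F [mF F0M _ _].
  rewrite integral_dirac//; last exact/measurable_EFinP.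
  by rewrite diracT mul1e lee_fin; case/andP: (F0M [tuple]).
exists (M' * (2 * `|T|)); first by rewrite mulr_ge0// mulr_ge0.
move=> F tF; have [mF F0M dF FT] := tF.
have F0 x : (0 <= (F x)%:E)%E by rewrite lee_fin; case/andP: (F0M x).
rewrite integral_lebesgue_tupleS//; last exact/measurable_EFinP.
have mFt : measurable_fun setT (fun z => (F (tcons z))%:E).
  apply/measurable_EFinP.
  exact: measurableT_comp mF (@measurable_tcons R n).
apply: (@le_trans _ (\bar R) (\int[mu]_(a in `[(- `|T|)%R, `|T|%R]) (cst M'%:E a))%E).
  rewrite [leRHS]integral_mkcond; apply: ge0_le_integral => //=.
  - by move=> a _; exact: integral_ge0.
  - exact: (measurable_fun_fubini_tonelli_F (fun z => (F (tcons z))%:E)).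
  - by apply: (measurable_restrictT _ _).1 => //; exact: measurable_cst.
  move=> a _; rewrite patchE; case: ifPn => [_|].
    by apply: IH; exact: tame_slice.
  rewrite notin_setE /= in_itv /= -ler_norml => /negP; rewrite -ltNge => Ta.
  rewrite integral0_eq// => v _; congr EFin; apply: (FT _ ord0).
  by rewrite tnth_tcons0; apply: le_lt_trans Ta; exact: ler_norm.
rewrite integral_cst//=.
rewrite lebesgue_measure_itv /= lte_fin; case: ifPn => _.
  by rewrite -EFinD opprK -EFinM lee_fin mulrDl mul1r.
by rewrite mule0 lee_fin mulr_ge0// mulr_ge0.
Qed.

Definition total n (F : n.-tuple R -> R) : R :=
  fine (\int[lebesgue_tuple R n]_x (F x)%:E)%E.

Definition marginal n (F : n.+1.-tuple R -> R) (a : R) : R :=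
  total (fun v => F (tcons (a, v))).

Lemma tame_ge0 n M T (F : n.-tuple R -> R) : tame M T F -> forall x, 0 <= F x.
Proof. by move=> [_ FM _ _] x; case/andP: (FM x). Qed.

Lemma tame_totalE n M T (F : n.-tuple R -> R) : tame M T F ->
  (\int[lebesgue_tuple R n]_x (F x)%:E)%E = (total F)%:E.
Proof.
move=> tF; have F0 := tame_ge0 tF; have [mF FM dF FT] := tF.
have M0 : 0 <= M by case/andP: (FM [tuple of nseq n 0]) => /le_trans; apply.
have [M' M'0 HM'] := tame_integral_bound n T M0.
rewrite /total fineK// ge0_fin_numE; first exact: le_lt_trans (HM' _ tF) (ltry _).
by apply: integral_ge0 => x _; rewrite lee_fin.
Qed.

Lemma total_ge0 n (F : n.-tuple R -> R) : (forall x, 0 <= F x) -> 0 <= total F.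
Proof.
by move=> F0; apply: fine_ge0; apply: integral_ge0 => x _; rewrite lee_fin.
Qed.

Section marginal.
Variables (n : nat) (M T : R) (F : n.+1.-tuple R -> R).
Hypothesis tF : tame M T F.

Lemma marginalE a :
  (\int[lebesgue_tuple R n]_v (F (tcons (a, v)))%:E)%E = (marginal F a)%:E.
Proof. exact: tame_totalE (tame_slice a tF). Qed.

Lemma marginal_ge0 a : 0 <= marginal F a.
Proof. by apply: total_ge0 => v; exact: tame_ge0 tF _. Qed.

Lemma measurable_marginal : measurable_fun setT (marginal F).
Proof.
have [mF FM _ _] := tF.
apply/measurable_EFinP.
have mFt : measurable_fun setT (fun z => (F (tcons z))%:E).
  apply/measurable_EFinP.
  exact: measurableT_comp mF (@measurable_tcons R n).
have F0 z : (0 <= (F (tcons z))%:E)%E by rewrite lee_fin; exact: tame_ge0 tF _.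
have := @measurable_fun_fubini_tonelli_F _ _ _ _ R (lebesgue_tuple R n) _ mFt F0.
by apply: eq_measurable_fun => a _ /=; rewrite /fubini_F marginalE.
Qed.

Lemma even_dec_marginal : even_dec (marginal F).
Proof.
move=> a b ab; rewrite -lee_fin -!marginalE.
have [_ FM dF _] := tF.
have [mFa _ _ _] := tame_slice a tF; have [mFb _ _ _] := tame_slice b tF.
apply: ge0_le_integral => //=.
- by move=> v _; rewrite lee_fin; exact: tame_ge0 tF _.
- exact/measurable_EFinP.
- exact/measurable_EFinP.
move=> v _; rewrite lee_fin; apply: dF => i.
by have [j ->|->] := unliftP ord0 i; rewrite ?tnth_tconsS.
Qed.

Lemma marginal_support a : T < `|a| -> marginal F a = 0.
Proof.
move=> Ta; rewrite /marginal /total integral0_eq// => v _; congr EFin.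
by have [_ _ _ FT] := tF; apply: (FT _ ord0); rewrite tnth_tcons0.
Qed.

Lemma integral_marginal :
  (\int[mu]_a (marginal F a)%:E)%E = (total F)%:E.
Proof.
have [mF FM _ _] := tF.
rewrite -(tame_totalE tF) integral_lebesgue_tupleS//.
- by apply: eq_integral => a _; rewrite marginalE.
- exact/measurable_EFinP.
- by move=> x; rewrite lee_fin; exact: tame_ge0 tF _.
Qed.

End marginal.

(** Induction on the dimension: the inequality for the tails says that the
marginals in the head coordinate satisfy the hypothesis on the line. *)
Lemma prekopa_leindler n M T (f g h : n.-tuple R -> R) :
  tame M T f -> tame M T g -> tame M T h ->
  (forall x y, f x * g y <= h (midpoint x y) ^+ 2) ->
  total f * total g <= total h ^+ 2.
Proof.
elim: n f g h => [|n IH] f g h tf tg th fgh.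
  have t0 (u : 0.-tuple R -> R) : tame M T u -> total u = u [tuple].
    move=> [mu_ _ _ _]; rewrite /total integral_dirac//; last exact/measurable_EFinP.
    by rewrite diracT mul1e.
  rewrite !t0//; apply: le_trans (fgh _ _) _.
  by rewrite (tuple0 (midpoint _ _)).
apply: (@prekopa_leindler_line R (marginal f) (marginal g) (marginal h) T).
- exact: measurable_marginal tf.
- exact: measurable_marginal tg.
- exact: measurable_marginal th.
- exact: marginal_ge0 tf.
- exact: marginal_ge0 tg.
- exact: marginal_ge0 th.
- exact: even_dec_marginal tf.
- exact: even_dec_marginal tg.
- exact: marginal_support tf.
- exact: marginal_support tg.
- move=> a b; apply: IH; [exact: tame_slice|exact: tame_slice|exact: tame_slice|].
  by move=> v w; rewrite -midpoint_tcons.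
- exact: integral_marginal tf.
- exact: integral_marginal tg.
- exact: integral_marginal th.
Qed.

(** The inequality for three parallel sections of one log-concave function. *)
Lemma marginal_log_concave n M T (F : n.+1.-tuple R -> R) a b : tame M T F ->
  (forall x y, F x * F y <= F (midpoint x y) ^+ 2) ->
  marginal F a * marginal F b <= marginal F ((a + b) / 2) ^+ 2.
Proof.
move=> tF FF; apply: (@prekopa_leindler n M T).
- exact: tame_slice.
- exact: tame_slice.
- exact: tame_slice.
- by move=> v w; rewrite -midpoint_tcons.
Qed.

End prekopa_leindler.

(** * The sixth moment of a coordinate is bounded *)

Section sixth_bound.
Variable R : realType.

(** Any absolute constant would do: this one comes from the decay estimates below. *)
Definition sixth_bound : R := 4 ^+ 6 + 4 ^+ 6 * 32 * 2 ^+ 21 * pi.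

Lemma sixth_bound_ge1 : 1 <= sixth_bound.
Proof.
have K0 : 0 <= 4 ^+ 6 * 32 * 2 ^+ 21 * pi :> R.
  by apply: mulr_ge0; rewrite ?pi_ge0// !mulr_ge0 ?exprn_ge0.
by rewrite ler_wpDr// exprn_ege1// ler1n.
Qed.

End sixth_bound.

Section sixth_moment_line.
Variable R : realType.
Local Notation mu := (@lebesgue_measure R).

Lemma integral_oneDsqrV :
  (\int[mu]_x ((oneDsqr x)^-1)%:E = (pi : R)%:E)%E.
Proof.
have c : continuous (fun x : R => (oneDsqr x)^-1).
  by move=> x; exact: continuous_oneDsqrV.
rewrite (@ge0_symfun_integralT R (fun x => (oneDsqr x)^-1))//.
- rewrite (_ : [set x | 0 <= x] = `[0, +oo[%classic); last first.
    by apply/seteqP; split => x; rewrite /= in_itv /= andbT.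
  by rewrite integral0y_oneDsqr -EFinM; congr EFin; field.
- by move=> x /=; rewrite /oneDsqr sqrrN.
Qed.

(** Here N is the density of one coordinate after truncation, hence with total mass
between 3/4 and 1 and second moment at most 1.  A second moment at most 1 gives the
decay x^-3; as N 0 is bounded below, N (2 x) N 0 <= N x ^ 2 squares the decay, and
using it twice yields x^-12, enough to integrate x^6. *)
Section bound.
Variable N : R -> R.
Hypotheses (mN : measurable_fun setT N) (N0 : forall x, 0 <= N x).
Hypothesis dN : even_dec N.
Hypothesis N_double : forall x, N (2 * x) * N 0 <= N x ^+ 2.
Hypothesis N_le1 : (\int[mu]_x (N x)%:E <= 1)%E.
Hypothesis N2_le1 : (\int[mu]_x (x ^+ 2 * N x)%:E <= 1)%E.
Hypothesis N_ge : ((3 / 4)%:E <= \int[mu]_x (N x)%:E)%E.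

Let mN2 : measurable_fun setT (fun x : R => x ^+ 2 * N x).
Proof. by apply: measurable_funM => //; exact: measurable_funX. Qed.

Let N_decay x : 0 < x -> N x <= 8 / x ^+ 3.
Proof.
move=> x0; have x3 : 0 < x ^+ 3 by rewrite exprn_gt0.
suff : ((x ^+ 2 / 4 * N x * (x / 2))%:E <= 1 :> \bar R)%E.
  by rewrite lee_fin ler_pdivlMr// => le; nra.
apply: le_trans N2_le1.
(* on [x / 2, x] the integrand is at least (x ^ 2 / 4) N x *)
apply: (@le_trans _ (\bar R) (\int[mu]_(y in `[(x / 2)%R, x]) (cst (x ^+ 2 / 4 * N x)%:E y))%E).
  rewrite integral_cst//= lebesgue_measure_itv /= lte_fin ifT; last lra.
  by rewrite -EFinD -EFinM lee_fin; have := N0 x; nra.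
rewrite integral_mkcond; apply: ge0_le_integral => //=.
- move=> y _; apply: erestrict_ge0 => z _; rewrite lee_fin.
  by rewrite mulr_ge0// divr_ge0// sqr_ge0.
- by apply: (measurable_restrictT _ _).1 => //; exact: measurable_cst.
- exact/measurable_EFinP.
move=> y _; rewrite patchE; case: ifPn => [|_]; last first.
  by rewrite lee_fin mulr_ge0// sqr_ge0.
rewrite inE /= in_itv /= lee_fin => /andP[xy yx].
apply: ler_pM => //; first by rewrite divr_ge0// sqr_ge0.
  nra.
by apply: dN; rewrite !ger0_norm; lra.
Qed.

Let N0_ge : 1 / 8 <= N 0.
Proof.
suff : ((3 / 4)%:E <= (4 * N 0 + 1 / 4)%:E :> \bar R)%E.
  rewrite lee_fin; lra.
apply: (le_trans N_ge).
(* outside [-2, 2] the mass is at most 1 / 4, by Chebyshev *)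
apply: (@le_trans _ (\bar R)
  (\int[mu]_x ((((fun=> (N 0)%:E) \_ `[(- 2)%R, 2%R]) x) + (4^-1)%:E * (x ^+ 2 * N x)%:E))%E).
  apply: ge0_le_integral => //=.
  - by move=> x _; rewrite lee_fin.
  - exact/measurable_EFinP.
  - apply: emeasurable_funD.
      by apply: (measurable_restrictT _ _).1 => //; exact: measurable_cst.
    by apply: emeasurable_funM => //; exact/measurable_EFinP.
  move=> x _; rewrite patchE; case: ifPn => [_|].
    rewrite -EFinM -EFinD lee_fin.
    have : N x <= N 0 by apply: dN; rewrite normr0.
    have : 0 <= x ^+ 2 * N x by rewrite mulr_ge0// sqr_ge0.
    lra.
  rewrite notin_setE /= in_itv /= -ler_norml => /negP; rewrite -ltNge => x2.
  rewrite add0e -EFinM lee_fin.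
  have : 2 ^+ 2 <= `|x| ^+ 2 by rewrite ler_pXn2r ?nnegrE// ltW.
  by rewrite real_normK ?num_real// => x4; have := N0 x; nra.
rewrite ge0_integralD//=.
- rewrite -integral_mkcond integral_cst//= lebesgue_measure_itv /= lte_fin ifT; last lra.
  rewrite ge0_integralZl_EFin//.
  + rewrite [leRHS]EFinD; apply: leeD.
      by rewrite -EFinD -EFinM lee_fin; have := N0 0; lra.
    rewrite div1r -[leRHS]mule1; apply: lee_wpmul2l => //.
  + by move=> x _; rewrite lee_fin mulr_ge0// sqr_ge0.
  + exact/measurable_EFinP.
- by move=> x _; apply: erestrict_ge0 => z _; rewrite lee_fin.
- by apply: (measurable_restrictT _ _).1 => //; exact: measurable_cst.
- by move=> x _; rewrite -EFinM lee_fin mulr_ge0// mulr_ge0// sqr_ge0.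
- by apply: emeasurable_funM => //; exact/measurable_EFinP.
Qed.

Let double x : N (2 * x) <= 8 * N x ^+ 2.
Proof.
have := N_double x; have := N0 (2 * x); have := N0_ge; nra.
Qed.

Let N_fast_decay x : 1 <= x -> N (4 * x) * x ^+ 12 <= 2 ^+ 21.
Proof.
move=> x1; have x0 : 0 < x by lra.
have x3 : 0 < x ^+ 3 by rewrite exprn_gt0.
have d1 : N x * x ^+ 3 <= 8.
  by rewrite -ler_pdivlMr//; exact: N_decay.
have d1' : 0 <= N x * x ^+ 3 by rewrite mulr_ge0// ltW.
have d2 : N (2 * x) * x ^+ 6 <= 8 * 64.
  apply: (@le_trans _ _ (8 * (N x * x ^+ 3) ^+ 2)).
    have -> : 8 * (N x * x ^+ 3) ^+ 2 = 8 * N x ^+ 2 * x ^+ 6 by ring.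
    by rewrite ler_pM2r ?exprn_gt0//; exact: double.
  nra.
have d2' : 0 <= N (2 * x) * x ^+ 6 by rewrite mulr_ge0// exprn_ge0// ltW.
apply: (@le_trans _ _ (8 * (N (2 * x) * x ^+ 6) ^+ 2)).
  have -> : 8 * (N (2 * x) * x ^+ 6) ^+ 2 = 8 * N (2 * x) ^+ 2 * x ^+ 12 by ring.
  rewrite ler_pM2r ?exprn_gt0//.
  by have := double (2 * x); rewrite mulrA -natrM.
apply: (@le_trans _ _ (8 * (8 * 64) ^+ 2)).
  by rewrite ler_pM2l// ler_pXn2r ?nnegrE//; lra.
have -> : 8 * (8 * 64) ^+ 2 = 2 ^+ 21 :> R by ring.
by [].
Qed.

Lemma sixth_moment_line :
  (\int[mu]_x (x ^+ 6 * N x)%:E <= (sixth_bound R)%:E)%E.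
Proof.
rewrite /sixth_bound.
have pw x : x ^+ 6 * N x <= 4 ^+ 6 * N x + (4 ^+ 6 * 32 * 2 ^+ 21) * (oneDsqr x)^-1.
  wlog x0 : x / 0 <= x => [H|].
    have [/H//|/ltW x0] := leP 0 x.
    have := H (- x); rewrite oppr_ge0 => /(_ x0).
    have -> : N (- x) = N x by apply/eqP; rewrite eq_le !dN// normrN.
    by rewrite /oneDsqr sqrrN (_ : (- x) ^+ 6 = x ^+ 6); [|ring].
  have o0 : 0 < oneDsqr x by rewrite (lt_le_trans ltr01)// oneDsqr_ge1.
  have o1 : 0 <= (4 ^+ 6 * 32 * 2 ^+ 21) * (oneDsqr x)^-1 :> R.
    by rewrite !mulr_ge0 ?exprn_ge0 ?invr_ge0 ?ltW.
  have [x4|x4] := leP x 4.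
    apply: (@le_trans _ _ (4 ^+ 6 * N x)); last by rewrite lerDl.
    by apply: ler_wpM2r => //; rewrite ler_pXn2r ?nnegrE.
  apply: (@le_trans _ _ ((4 ^+ 6 * 32 * 2 ^+ 21) * (oneDsqr x)^-1)); last first.
    by rewrite lerDr mulr_ge0// exprn_ge0.
  rewrite ler_pdivlMr//.
  pose y := x / 4; have y1 : 1 <= y by rewrite /y ler_pdivlMr//; lra.
  have -> : x = 4 * y by rewrite /y; field.
  have := N_fast_decay y1.
  have -> : N (4 * y) * y ^+ 12 = (N (4 * y) * y ^+ 8) * y ^+ 4 by ring.
  set P := N (4 * y) * y ^+ 8 => le.
  have P0 : 0 <= P by rewrite mulr_ge0// exprn_ge0//; lra.
  have y2 : 1 <= y ^+ 2 by rewrite exprn_ege1.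
  have y4 : 1 <= y ^+ 4 by rewrite exprn_ege1.
  apply: (@le_trans _ _ (4 ^+ 6 * 32 * P)).
    rewrite /oneDsqr /P.
    have -> : (4 * y) ^+ 6 * N (4 * y) * (1 + (4 * y) ^+ 2) =
       4 ^+ 6 * (N (4 * y) * y ^+ 6) * (1 + 16 * y ^+ 2) by ring.
    have -> : 4 ^+ 6 * 32 * (N (4 * y) * y ^+ 8) =
       4 ^+ 6 * (N (4 * y) * y ^+ 6) * (32 * y ^+ 2) by ring.
    apply: ler_wpM2l; last lra.
    by rewrite mulr_ge0 ?exprn_ge0// mulr_ge0// exprn_ge0//; lra.
  rewrite ler_pM2l ?mulr_gt0 ?exprn_gt0//.
  apply: le_trans le; rewrite ler_peMr//.
apply: (@le_trans _ (\bar R)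
  (\int[mu]_x ((4 ^+ 6)%:E * (N x)%:E + ((4 ^+ 6 * 32 * 2 ^+ 21))%:E * ((oneDsqr x)^-1)%:E))%E).
  apply: ge0_le_integral => //=.
  - by move=> x _; rewrite lee_fin mulr_ge0// exprn_even_ge0.
  - by apply/measurable_EFinP/measurable_funM => //; exact: measurable_funX.
  - apply: emeasurable_funD; apply: emeasurable_funM => //; apply/measurable_EFinP => //.
    by apply: continuous_measurable_fun => x; exact: continuous_oneDsqrV.
  by move=> x _; rewrite -!EFinM -EFinD lee_fin.
have oV x : 0 <= (oneDsqr x)^-1 :> R by rewrite invr_ge0 addr_ge0// sqr_ge0.
have mo : measurable_fun setT (fun x : R => ((oneDsqr x)^-1)%:E).
  apply/measurable_EFinP.
  by apply: continuous_measurable_fun => x; exact: continuous_oneDsqrV.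
have mEN : measurable_fun setT (fun x : R => (N x)%:E) by exact/measurable_EFinP.
rewrite ge0_integralD//=.
- have K0 : 0 <= 4 ^+ 6 * 32 * 2 ^+ 21 :> R by rewrite !mulr_ge0 ?exprn_ge0.
  rewrite !ge0_integralZl_EFin ?exprn_ge0//.
  + rewrite integral_oneDsqrV [leRHS]EFinD -!EFinM; apply: leeD => //.
    by rewrite -[leRHS]mule1; apply: lee_wpmul2l => //; rewrite lee_fin exprn_ge0.
  + by move=> x _; rewrite lee_fin.
- by move=> x _; rewrite -EFinM lee_fin mulr_ge0// exprn_ge0.
- exact: emeasurable_funM.
- exact: emeasurable_funM.
Qed.

End bound.
End sixth_moment_line.

Section truncation.
Variable R : realType.

Definition box n (T : R) : set (n.-tuple R) :=
  \bigcap_(i in [set: 'I_n]) ((@tnth n R)^~ i @^-1` `[- T, T]).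

Lemma boxP n T (x : n.-tuple R) : box T x <-> forall i, `|tnth x i| <= T.
Proof.
split=> [bx i|bx i _]; first by have := bx i I; rewrite /= in_itv /= ler_norml.
by rewrite /= in_itv /= -ler_norml.
Qed.

Lemma measurable_box n T : measurable (@box n T).
Proof.
apply: fin_bigcap_measurable => // i _.
rewrite -[X in measurable X]setTI; exact: measurable_tnth.
Qed.

(** Truncation to a box keeps log-concavity and monotonicity, and makes the density
tame. *)
Definition truncate n T (F : n.-tuple R -> R) x := F x * \1_(box T) x.

Section truncate.
Variables (n : nat) (T : R) (F : n.-tuple R -> R).
Hypotheses (mF : measurable_fun setT F) (F0 : forall x, 0 <= F x).
Hypothesis dF : coord_dec F.
Hypothesis FF : forall x y, F x * F y <= F (midpoint x y) ^+ 2.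

Lemma truncate_in x : box T x -> truncate T F x = F x.
Proof. by move=> bx; rewrite /truncate indicE mem_set// mulr1. Qed.

Lemma truncate_out x : ~ box T x -> truncate T F x = 0.
Proof. by move=> bx; rewrite /truncate indicE memNset// mulr0. Qed.

Lemma truncate_ge0 x : 0 <= truncate T F x.
Proof. by rewrite mulr_ge0. Qed.

Lemma tame_truncate : tame (F [tuple of nseq n 0]) T (truncate T F).
Proof.
split.
- apply: measurable_funM => //; apply: measurable_indic; exact: measurable_box.
- move=> x; rewrite truncate_ge0 /=; have [bx|bx] := pselect (box T x).
    rewrite truncate_in//; apply: dF => i.
    by rewrite (tnth_nth 0) /= nth_nseq ltn_ord normr0.
  by rewrite truncate_out.
- move=> x y xy; have [by_|by_] := pselect (box T y); last first.
    by rewrite (truncate_out by_) truncate_ge0.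
  have bx : box T x.
    by apply/boxP => i; apply: le_trans (xy i) _; have/boxP := by_; apply.
  by rewrite !truncate_in//; exact: dF.
- move=> x i Tx; rewrite truncate_out// => /boxP/(_ i).
  by rewrite leNgt Tx.
Qed.

Lemma truncate_log_concave x y :
  truncate T F x * truncate T F y <= truncate T F (midpoint x y) ^+ 2.
Proof.
have [bx|bx] := pselect (box T x); last first.
  by rewrite (truncate_out bx) mul0r sqr_ge0.
have [by_|by_] := pselect (box T y); last first.
  by rewrite (truncate_out by_) mulr0 sqr_ge0.
suff bm : box T (midpoint x y) by rewrite !truncate_in.
apply/boxP => i; rewrite tnth_mktuple normrM normfV (@ger0_norm _ 2)//.
rewrite ler_pdivrMr//.
have/boxP/(_ i) hx := bx; have/boxP/(_ i) hy := by_.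
have := ler_normD (tnth x i) (tnth y i); lra.
Qed.

End truncate.
End truncation.

Section sixth_moment.
Variables (R : realType) (n : nat) (eta : probability (n.+1.-tuple R) R).
Variable F : n.+1.-tuple R -> R.
Hypotheses (mF : measurable_fun setT F) (F0 : forall x, 0 <= F x).
Hypothesis dF : coord_dec F.
Hypothesis FF : forall x y, F x * F y <= F (midpoint x y) ^+ 2.
Hypothesis etaF : density eta F.
Hypothesis eta2 : (\int[eta]_x (tnth x ord0 ^+ 2)%:E = 1)%E.
Local Notation mu := (@lebesgue_measure R).

Lemma integral_truncate T (k : R -> R) : measurable_fun setT k ->
  (forall a, 0 <= k a) ->
  (\int[mu]_a (k a * marginal (truncate T F) a)%:E =
   \int[eta]_(x in box T) (k (tnth x ord0))%:E)%E.
Proof.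
move=> mk k0; have tF := tame_truncate T mF F0 dF.
have [mT _ _ _] := tF.
have mkx : measurable_fun setT (fun x : n.+1.-tuple R => k (tnth x ord0)).
  by apply: measurableT_comp => //; exact: measurable_tnth.
rewrite [RHS]integral_mkcond (integral_density mF F0 etaF); last 2 first.
- apply: (measurable_restrictT _ _).1; first exact: measurable_box.
  by apply: measurable_funTS; exact/measurable_EFinP.
- by move=> x; apply: erestrict_ge0 => y _; rewrite lee_fin.
transitivity (\int[lebesgue_tuple R n.+1]_x (k (tnth x ord0) * truncate T F x)%:E)%E.
  rewrite integral_lebesgue_tupleS//; last 2 first.
  - by apply/measurable_EFinP; exact: measurable_funM.
  - by move=> x; rewrite lee_fin mulr_ge0// truncate_ge0.
  apply: eq_integral => a _; rewrite EFinM -(marginalE tF).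
  rewrite -ge0_integralZl_EFin//.
  - by move=> v _; rewrite lee_fin truncate_ge0.
  - apply/measurable_EFinP; have [mS _ _ _] := tame_slice a tF; exact: mS.
apply: eq_integral => x _; rewrite patchE; case: ifPn => bx.
  by rewrite truncate_in ?EFinM//; rewrite inE in bx.
by rewrite truncate_out ?mulr0 ?mul0e//; rewrite notin_setE in bx.
Qed.

Lemma box_nondecreasing : nondecreasing_seq (fun i : nat => @box R n.+1 i%:R).
Proof.
move=> i j ij; rewrite subsetEset => x /boxP bx; apply/boxP => l.
by rewrite (le_trans (bx l))// ler_nat.
Qed.

Lemma bigcup_box : \bigcup_(i : nat) @box R n.+1 i%:R = setT.
Proof.
apply/seteqP; split => // x _.
exists (\max_(l < n.+1) (Num.trunc `|tnth x l|).+1)%N => //; apply/boxP => l.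
apply: (@le_trans _ _ (Num.trunc `|tnth x l|).+1%:R).
  by rewrite ltW// truncnS_gt.
by rewrite ler_nat (@leq_bigmax _ (fun l => (Num.trunc `|tnth x l|).+1)).
Qed.

(** The bound on the line applies to the truncation to every large box, and the boxes
exhaust the space. *)
Lemma sixth_moment_bound :
  (\int[eta]_x (tnth x ord0 ^+ 6)%:E <= (sixth_bound R)%:E)%E.
Proof.
have mpow k : measurable_fun setT (fun x : n.+1.-tuple R => (tnth x ord0 ^+ k)%:E).
  by apply/measurable_EFinP/measurable_funX; exact: measurable_tnth.
have [i0 Hi0] : exists i0, forall i, (i0 <= i)%N ->
    ((3 / 4)%:E <= eta (@box R n.+1 i%:R))%E.
  have cv : (fun i => eta (@box R n.+1 i%:R)) @ \oo --> 1%E.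
    rewrite -(probability_setT eta) -bigcup_box.
    apply: nondecreasing_cvg_mu; last exact: box_nondecreasing.
      by move=> i; exact: measurable_box.
    by rewrite bigcup_box.
  have : \forall i \near \oo, ((3 / 4)%:E <= eta (@box R n.+1 i%:R))%E.
    move/fine_cvgP : cv => [fin /cvgrPdist_lt /(_ (1 / 4))].
    have e4 : 0 < 1 / 4 :> R by lra.
    move=> /(_ e4) cv; near=> i.
    have fi : eta (@box R n.+1 i%:R) \is a fin_num by near: i; exact: fin.
    have : `|1 - fine (eta (@box R n.+1 i%:R))| < 1 / 4 by near: i; exact: cv.
    rewrite -(fineK fi) lee_fin ltr_norml; lra.
  by move=> [i0 _ H]; exists i0 => i ii0; exact: H.
have cvg6 := ge0_nondecreasing_set_cvg_integral (mu := eta) box_nondecreasing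
  (fun i => measurable_box _) (fun i => measurable_funTS (mpow 6))
  (fun i x _ => exprn_even_ge0 (tnth x ord0) (isT : ~~ odd 6)).
rewrite -bigcup_box -(cvg_lim _ cvg6)//; apply: lime_le.
  by apply/cvg_ex; eexists; exact: cvg6.
exists i0 => // i /= ii0; set T := i%:R.
have tF := tame_truncate T mF F0 dF.
rewrite -(@integral_truncate T (fun a => a ^+ 6)); last 2 first.
- exact: measurable_funX.
- by move=> a; exact: exprn_even_ge0.
have m0 : (\int[mu]_a (marginal (truncate T F) a)%:E = eta (@box R n.+1 T))%E.
  under eq_integral do rewrite -[marginal _ _]mul1r.
  rewrite (@integral_truncate T (fun=> 1))//.
  by rewrite integral_cst ?mul1e//; exact: measurable_box.
apply: sixth_moment_line.
- exact: measurable_marginal tF.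
- exact: marginal_ge0 tF.
- exact: even_dec_marginal tF.
- move=> a; have := marginal_log_concave (2 * a) 0 tF (truncate_log_concave T FF).
  by rewrite addr0 mulrAC divff// mul1r.
- by rewrite m0 probability_le1//; exact: measurable_box.
- rewrite (@integral_truncate T (fun a => a ^+ 2)); last 2 first.
  + exact: measurable_funX.
  + by move=> a; exact: sqr_ge0.
  rewrite -eta2; apply: ge0_subset_integral => //.
  + exact: measurable_box.
  + by move=> x _; rewrite lee_fin sqr_ge0.
- by rewrite m0; exact: Hi0.
Unshelve. all: by end_near. Qed.

End sixth_moment.

(** * Inequalities inherited from symmetric intervals *)

Section unimodal_expectation.
Variable R : realType.
Local Notation mu := (@lebesgue_measure R).

(** Fundamental theorem of calculus for polynomials. *)
Lemma integral_deriv_poly (q : {poly R}) s : 0 <= s ->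
  (\int[mu]_(a in `[(- s)%R, s]) (q^`().[a])%:E = (q.[s] - q.[- s])%:E)%E.
Proof.
rewrite le_eqVlt => /predU1P[<-|s0].
  by rewrite oppr0 set_itv1 integral_set1 subrr.
rewrite (@continuous_FTC2 R (fun a => q^`().[a]) (fun a => q.[a])).
- by rewrite EFinB.
- lra.
- by apply: continuous_subspaceT => a; exact: continuous_horner.
- split.
  + by move=> a _; exact: derivable_horner.
  + by apply: cvg_at_right_filter; exact: continuous_horner.
  + by apply: cvg_at_left_filter; exact: continuous_horner.
- by move=> a _; rewrite -derivE.
Qed.

Variables (n : nat) (eta : probability (n.+1.-tuple R) R).
Variable F : n.+1.-tuple R -> R.
Hypotheses (mF : measurable_fun setT F) (F0 : forall x, 0 <= F x).
Hypothesis dF : coord_dec F.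
Hypothesis etaF : density eta F.

Variables (W H : n.+1.-tuple R -> R) (q : n.-tuple R -> {poly R}).
Hypotheses (mW : measurable_fun setT W) (W0 : forall x, 0 <= W x).
Hypothesis dW : forall v, even_dec (fun a => W (tcons (a, v))).
Hypothesis mH : measurable_fun setT H.
Hypothesis Hq : forall a v, H (tcons (a, v)) = (q v)^`().[a].
Hypothesis q_inc : forall v s, 0 <= s ->
  (forall a, `|a| < s -> 0 < W (tcons (a, v))) -> (q v).[- s] <= (q v).[s].

Let mslice (G : n.+1.-tuple R -> R) v : measurable_fun setT G ->
  measurable_fun setT (fun a => G (tcons (a, v))).
Proof.
move=> mG; have mGt : measurable_fun setT (fun z => G (tcons z)).
  exact: measurableT_comp mG (@measurable_tcons R n).
exact: (measurableT_comp mGt (measurable_pair2 v)).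
Qed.

(** The primitive q v of H (., v) not decreasing from -s to s means that H has a
nonnegative integral over [-s, s].  Comparing its negative and positive parts
instead of integrating H keeps every integrand nonnegative, as Tonelli requires. *)
Lemma unimodal_negpart_le :
  (\int[eta]_x (W x * Num.max (- H x) 0)%:E <=
   \int[eta]_x (W x * Num.max (H x) 0)%:E)%E.
Proof.
have mHp : measurable_fun setT (fun x => Num.max (H x) 0) by exact: measurable_maxr.
have mHn : measurable_fun setT (fun x => Num.max (- H x) 0).
  by apply: measurable_maxr => //; exact: measurableT_comp.
have max0 (z : R) : 0 <= Num.max z 0 by rewrite le_max lexx orbT.
have fib (K : n.+1.-tuple R -> R) : measurable_fun setT K -> (forall x, 0 <= K x) ->
    (\int[eta]_x (W x * K x)%:E = \int[lebesgue_tuple R n]_v \int[mu]_a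
      ((F (tcons (a, v)) * W (tcons (a, v)))%:E * (K (tcons (a, v)))%:E))%E.
  move=> mK K0; rewrite (integral_density mF F0 etaF).
  - rewrite integral_lebesgue_tupleS_swap.
    + apply: eq_integral => v _; apply: eq_integral => a _.
      by rewrite -!EFinM mulrC mulrA.
    + by apply: emeasurable_funM; apply/measurable_EFinP => //; exact: measurable_funM.
    + by move=> x; rewrite -EFinM lee_fin mulr_ge0// mulr_ge0.
  - by apply/measurable_EFinP; exact: measurable_funM.
  - by move=> x; rewrite lee_fin mulr_ge0.
rewrite (fib (fun x => Num.max (- H x) 0))// (fib (fun x => Num.max (H x) 0))//.
have mfib (K : n.+1.-tuple R -> R) : measurable_fun setT K -> (forall x, 0 <= K x) ->
    measurable_fun setT (fun v => \int[mu]_a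
      ((F (tcons (a, v)) * W (tcons (a, v)))%:E * (K (tcons (a, v)))%:E))%E.
  move=> mK K0.
  apply: (measurable_fun_fubini_tonelli_G (fun z =>
    ((F (tcons z) * W (tcons z))%:E * (K (tcons z))%:E)%E)).
    have mt := @measurable_tcons R n.
    apply: emeasurable_funM; apply/measurable_EFinP.
      by apply: measurable_funM; exact: measurableT_comp mt.
    exact: measurableT_comp mt.
  by move=> z; rewrite -EFinM lee_fin mulr_ge0// mulr_ge0.
apply: ge0_le_integral => //.
- move=> v _; apply: integral_ge0 => a _.
  by rewrite -EFinM lee_fin mulr_ge0// mulr_ge0.
- exact: (mfib (fun x => Num.max (- H x) 0)).
- exact: (mfib (fun x => Num.max (H x) 0)).
move=> v _.
apply: (@unimodal_integral_le R (fun a => F (tcons (a, v)) * W (tcons (a, v)))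
  (fun a => (Num.max (- H (tcons (a, v))) 0)%:E)
  (fun a => (Num.max (H (tcons (a, v))) 0)%:E)).
- by apply: measurable_funM; exact: mslice.
- by move=> a; rewrite mulr_ge0.
- move=> a b ab; apply: ler_pM => //; last exact: dW.
  apply: dF => i.
  by have [j ->|->] := unliftP ord0 i; rewrite ?tnth_tconsS.
- by apply/measurable_EFinP; exact: (mslice v mHn).
- by move=> a; rewrite lee_fin.
- by apply/measurable_EFinP; exact: (mslice v mHp).
- by move=> a; rewrite lee_fin.
move=> s s0 spos.
have Wpos a : `|a| < s -> 0 < W (tcons (a, v)).
  move=> /spos; rewrite lt_neqAle eq_sym mulf_eq0 negb_or => /andP[/andP[_ W1] _].
  by rewrite lt_neqAle eq_sym W1 W0.
have iH : mu.-integrable `[(- s)%R, s] (EFin \o (fun a => H (tcons (a, v)))).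
  apply: continuous_compact_integrable; first exact: segment_compact.
  apply: continuous_subspaceT => a.
  rewrite (_ : (fun a => H (tcons (a, v))) = horner (q v)^`()).
    exact: continuous_horner.
  by apply/funext => b; rewrite Hq.
have iHval : (\int[mu]_(a in `[(- s)%R, s]) (H (tcons (a, v)))%:E =
    ((q v).[s] - (q v).[- s])%:E)%E.
  by rewrite -integral_deriv_poly//; apply: eq_integral => a _; rewrite Hq.
have : (0 <= \int[mu]_(a in `[(- s)%R, s]) (H (tcons (a, v)))%:E)%E.
  by rewrite iHval lee_fin subr_ge0; exact: q_inc.
rewrite integralE.
have fE a : ((fun a => (H (tcons (a, v)))%:E)^\- a = (Num.max (- H (tcons (a, v))) 0)%:E)%E.
  by rewrite funenegE -EFinN -EFin_max.
have pE a : ((fun a => (H (tcons (a, v)))%:E)^\+ a = (Num.max (H (tcons (a, v))) 0)%:E)%E.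
  by rewrite funeposE -EFin_max.
rewrite (eq_integral _ _ (fun a _ => fE a)) (eq_integral _ _ (fun a _ => pE a)).
rewrite sube_ge0//.
apply/orP; left.
rewrite -(eq_integral _ _ (fun a _ => fE a)).
exact: integrable_neg_fin_num.
Qed.

Lemma unimodal_expectation :
  eta.-integrable setT (EFin \o (fun x => W x * H x)) ->
  0 <= Rintegral eta setT (fun x => W x * H x).
Proof.
move=> iWH; have := unimodal_negpart_le.
have fE x : ((EFin \o (fun x => (W x * H x)%R))^\- x = (W x * Num.max (- H x) 0)%:E)%E.
  rewrite funenegE /= -EFin_max; congr EFin.
  by rewrite -mulrN maxr_pMr// mulr0.
have pE x : ((EFin \o (fun x => (W x * H x)%R))^\+ x = (W x * Num.max (H x) 0)%:E)%E.
  by rewrite funeposE /= -EFin_max; congr EFin; rewrite maxr_pMr// mulr0.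
move=> le; apply: fine_ge0; rewrite integralE.
rewrite sube_ge0; last first.
  by apply/orP; left; exact: integrable_neg_fin_num.
by rewrite (eq_integral _ _ (fun a _ => fE a)) (eq_integral _ _ (fun a _ => pE a)).
Qed.

End unimodal_expectation.

(** * Moments of degree six *)

Section invariance.
Variables (R : realType) (n : nat) (eta : probability (n.-tuple R) R).

(** Transports positive and negative parts separately. *)
Lemma integral_invariant (T : n.-tuple R -> n.-tuple R) (g : n.-tuple R -> \bar R) :
  measurable_fun setT T -> invariant_under T eta -> measurable_fun setT g ->
  (\int[eta]_x g (T x) = \int[eta]_x g x)%E.
Proof.
move=> mT inv mg.
have ge0 (h : n.-tuple R -> \bar R) : measurable_fun setT h ->
    (forall x, 0 <= h x)%E -> (\int[eta]_x h (T x) = \int[eta]_x h x)%E.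
  move=> mh h0; have := ge0_integral_pushforward mT eta measurableT mh.
  rewrite preimage_setT => <-//.
  by apply: eq_measure_integral => //= A mA _; exact: inv.
rewrite integralE [RHS]integralE; congr (_ - _)%E.
- rewrite -(ge0 (g^\+)%E)//; last exact: measurable_funepos.
  by apply: eq_integral => x _; rewrite !funeposE.
- rewrite -(ge0 (g^\-)%E)//; last exact: measurable_funeneg.
  by apply: eq_integral => x _; rewrite !funenegE.
Qed.

Lemma Rintegral_invariant (T : n.-tuple R -> n.-tuple R) (g : n.-tuple R -> R) :
  measurable_fun setT T -> invariant_under T eta -> measurable_fun setT g ->
  \int[eta]_x g (T x) = \int[eta]_x g x.
Proof.
move=> mT inv mg; congr fine.
by apply: (@integral_invariant _ (EFin \o g)) => //; exact/measurable_EFinP.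
Qed.

End invariance.

Section moments.
Variables (R : realType) (n : nat) (eta : probability (n.+1.-tuple R) R).
Hypotheses (eta_inv : Hn_invariant eta) (eta_iso : isotropic eta).
Hypothesis eta_lc : log_concave eta.
Local Notation T := (n.+1.-tuple R).
Implicit Types (g : T -> R) (i j k : 'I_n.+1).

Lemma measurable_coord i : measurable_fun setT (fun x : T => tnth x i).
Proof. exact: measurable_tnth. Qed.

Lemma measurable_coordX i (d : nat) :
  measurable_fun setT (fun x : T => tnth x i ^+ d).
Proof. by apply: measurable_funX; exact: measurable_coord. Qed.

Lemma isotropic_second_moment i : (\int[eta]_x (tnth x i ^+ 2)%:E = 1)%E.
Proof.
have [m0 cov] := eta_iso; have := cov i i; rewrite eqxx.
rewrite covariance.unlock !m0 /= unlock => <-.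
by apply: eq_integral => x _; rewrite /= !fctE /= !subr0 expr2.
Qed.

Lemma coord_sixth_moment i : (\int[eta]_x (tnth x i ^+ 6)%:E <= (sixth_bound R)%:E)%E.
Proof.
have [F [mF F0 dF FF etaF]] := even_density eta_inv.2 eta_lc.
have := sixth_moment_bound mF F0 dF FF etaF (isotropic_second_moment ord0).
apply: le_trans.
have me : measurable_fun setT (fun x : T => (tnth x i ^+ 6)%:E).
  by apply/measurable_EFinP; exact (@measurable_coordX i 6).
rewrite -(@integral_invariant _ _ _ (permute (tperm i ord0)) (fun x => (tnth x i ^+ 6)%:E)
  (@measurable_permute _ _ _) (eta_inv.1 _))//.
by under eq_integral do rewrite tnth_mktuple tpermL.
Qed.

(** Finite sixth moments make all polynomials of degree at most six integrable; this
is the common integrable majorant. *)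
Definition dominated g := measurable_fun setT g /\
  exists c, forall x, `|g x| <= c * (1 + \sum_i tnth x i ^+ 6).

Lemma dominated_integrable g : dominated g -> eta.-integrable setT (EFin \o g).
Proof.
move=> [mg [c gc]].
have iX i : eta.-integrable setT (fun x => (tnth x i ^+ 6)%:E).
  apply/integrableP; split.
    by apply/measurable_EFinP; exact (@measurable_coordX i 6).
  under eq_integral do rewrite gee0_abs ?lee_fin ?exprn_even_ge0//.
  exact: le_lt_trans (coord_sixth_moment i) (ltry _).
have i1 : eta.-integrable setT (fun x : T => 1%E).
  by apply: finite_measure_integrable_cst.
have is6 : eta.-integrable setT (fun x => \sum_(i < n.+1) (tnth x i ^+ 6)%:E)%E.
  exact: integrable_sum.
have := integrableZl measurableT c (integrableD measurableT i1 is6).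
apply: le_integrable => //; first exact/measurable_EFinP.
move=> x _; rewrite /= sumEFin -EFinD -EFinM /= lee_fin.
by apply: le_trans (gc x) _; exact: ler_norm.
Qed.

(** m is the largest |x_i|. *)
Lemma norm_bound (x : T) : exists2 m, 0 <= m &
  (forall i, `|tnth x i| <= m) /\ m ^+ 6 <= \sum_i tnth x i ^+ 6.
Proof.
pose i := [arg max_(i > ord0) `|tnth x i|]%O.
exists `|tnth x i|; first by [].
split=> [j|]; first by rewrite /i; case: arg_maxP => //= l _; apply.
rewrite -normrX ger0_norm ?exprn_even_ge0// (bigD1 i)//= lerDl.
by apply: sumr_ge0 => l _; rewrite exprn_even_ge0.
Qed.

Lemma dominated_le g (k : nat) : (k <= 6)%N -> measurable_fun setT g ->
  (exists2 c, 0 <= c & forall x m, 0 <= m -> (forall i, `|tnth x i| <= m) ->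
    `|g x| <= c * m ^+ k) -> dominated g.
Proof.
move=> k6 mg [c c0 gc]; split => //; exists c => x.
have [m m0 [xm m6]] := norm_bound x.
apply: le_trans (gc x m m0 xm) _; apply: ler_wpM2l => //.
apply: (@le_trans _ _ (1 + m ^+ 6)); last by rewrite lerD2l.
have [m1|m1] := leP m 1.
  by rewrite ler_wpDr ?exprn_ge0// exprn_ile1.
by rewrite ler_wpDl// ler_weXn2l// ltW.
Qed.

Lemma dominatedD g1 g2 : dominated g1 -> dominated g2 ->
  dominated (fun x => g1 x + g2 x).
Proof.
move=> [m1 [c1 b1]] [m2 [c2 b2]]; split; first exact: measurable_funD.
exists (c1 + c2) => x; rewrite mulrDl.
by apply: le_trans (ler_normD _ _) _; exact: lerD.
Qed.

Lemma dominatedZ c g : dominated g -> dominated (fun x => c * g x).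
Proof.
move=> [mg [d b]]; split; first exact: measurable_funM.
by exists (`|c| * d) => x; rewrite normrM -mulrA ler_wpM2l.
Qed.

Lemma dominated_sum (I : Type) (s : seq I) (P : pred I) (g : I -> T -> R) :
  (forall l, P l -> dominated (g l)) ->
  dominated (fun x => \sum_(l <- s | P l) g l x).
Proof.
move=> dg; elim: s => [|i s IH].
  under eq_fun do rewrite big_nil.
  by split; [exact: measurable_cst|exists 0 => x; rewrite normr0 mul0r].
under eq_fun do rewrite big_cons.
by case: (boolP (P i)) => // Pi; apply: dominatedD => //; exact: dg.
Qed.

Lemma Rintegral_lincomb (I : Type) (s : seq I) (P : pred I) (c : I -> R)
    (g : I -> T -> R) : (forall l, P l -> dominated (g l)) ->
  \int[eta]_x (\sum_(l <- s | P l) c l * g l x) =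
  \sum_(l <- s | P l) c l * \int[eta]_x g l x.
Proof.
move=> dg; elim: s => [|i s IH].
  rewrite big_nil; under eq_Rintegral do rewrite big_nil.
  by rewrite Rintegral_cst// mul0r.
rewrite big_cons; under eq_Rintegral do rewrite big_cons.
case: (boolP (P i)) => // Pi.
rewrite RintegralD//.
- rewrite RintegralZl ?IH//; exact/dominated_integrable/dg.
- exact/dominated_integrable/dominatedZ/dg.
- apply/dominated_integrable/dominated_sum => l Pl; exact/dominatedZ/dg.
Qed.

Lemma le_Rintegral_dominated g h : dominated g -> dominated h ->
  (forall x, g x <= h x) -> \int[eta]_x g x <= \int[eta]_x h x.
Proof.
by move=> dg dh gh; apply: le_Rintegral => //; exact: dominated_integrable.
Qed.

Definition mon i j k (x : T) := tnth x i ^+ 2 * tnth x j ^+ 2 * tnth x k ^+ 2.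

Lemma mon_ge0 i j k x : 0 <= mon i j k x.
Proof. by apply: mulr_ge0; [apply: mulr_ge0|]; exact: sqr_ge0. Qed.

Lemma dominated_mon i j k : dominated (mon i j k).
Proof.
apply: (@dominated_le _ 6) => //.
  by apply: measurable_funM; [apply: measurable_funM|]; exact: measurable_coordX.
exists 1 => // x m m0 xm; rewrite mul1r ger0_norm ?mon_ge0// /mon.
have -> : m ^+ 6 = m ^+ 2 * m ^+ 2 * m ^+ 2 by ring.
have X2 l : tnth x l ^+ 2 <= m ^+ 2.
  by rewrite -[tnth x l ^+ 2]real_normK ?num_real// ler_pXn2r ?nnegrE.
have := X2 i; have := X2 j; have := X2 k.
have := sqr_ge0 (tnth x i); have := sqr_ge0 (tnth x j); have := sqr_ge0 (tnth x k).
move=> c0 b0 a0 kc jb ia; apply: ler_pM => //; first exact: mulr_ge0.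
exact: ler_pM.
Qed.

Lemma dominated_sq i : dominated (fun x => tnth x i ^+ 2).
Proof.
apply: (@dominated_le _ 2) => //; first exact: measurable_coordX.
exists 1 => // x m m0 xm /=; rewrite mul1r normrX.
by rewrite ler_pXn2r ?nnegrE.
Qed.

Definition moment i j k := \int[eta]_x mon i j k x.

Lemma moment_permute (s : {perm 'I_n.+1}) i j k :
  moment (s i) (s j) (s k) = moment i j k.
Proof.
have [mm _] := dominated_mon i j k.
rewrite -[RHS](@Rintegral_invariant _ _ _ (permute s) (mon i j k)
  (@measurable_permute _ _ _) (eta_inv.1 _))//.
by apply: eq_Rintegral => x _; rewrite /mon !tnth_mktuple.
Qed.

Lemma Rintegral_sq i : \int[eta]_x (tnth x i ^+ 2) = 1.
Proof. by rewrite /Rintegral isotropic_second_moment. Qed.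

Lemma moment_ge0 i j k : 0 <= moment i j k.
Proof. by apply: Rintegral_ge0 => x _; exact: mon_ge0. Qed.

Lemma moment_sixth i : moment i i i <= sixth_bound R.
Proof.
rewrite -lee_fin /moment /Rintegral fineK; last first.
  apply: integrable_fin_num => //.
  exact: dominated_integrable (dominated_mon i i i).
apply: le_trans (coord_sixth_moment i).
rewrite le_eqVlt; apply/orP; left; apply/eqP.
by apply: eq_integral => x _; rewrite /mon; congr EFin; ring.
Qed.

(** AM-GM: a^2 b <= (2 a^3 + b^3) / 3 for the squares a, b of two coordinates. *)
Lemma moment_le_sixth i j : moment i i j <= moment i i i.
Proof.
have -> : moment i i i = 2 / 3 * moment i i i + 1 / 3 * moment j j j.
  by rewrite -(moment_permute (tperm i j) i i i) tpermL; field.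
have E c l : c * moment l l l = \int[eta]_x (c * mon l l l x).
  by rewrite RintegralZl//; exact: dominated_integrable (dominated_mon _ _ _).
have D c l : dominated (fun x => c * mon l l l x).
  exact/dominatedZ/dominated_mon.
rewrite !E -RintegralD//; try exact: dominated_integrable.
apply: le_Rintegral_dominated.
- exact: dominated_mon.
- by apply: dominatedD; apply: dominatedZ; exact: dominated_mon.
move=> x; rewrite /mon; set a := tnth x i ^+ 2; set b := tnth x j ^+ 2.
have a0 : 0 <= a by exact: sqr_ge0.
have b0 : 0 <= b by exact: sqr_ge0.
rewrite -subr_ge0.
have -> : 2 / 3 * (a * a * a) + 1 / 3 * (b * b * b) - a * a * b =
  (a - b) ^+ 2 * (2 * a + b) / 3 by field.
by rewrite divr_ge0// mulr_ge0 ?sqr_ge0// addr_ge0// mulr_ge0.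
Qed.

(** The tangent of r^3 at r = N, the mean of r = |x|^2: r^3 >= 3 N^2 r - 2 N^3. *)
Lemma sum_moments_ge :
  n.+1%:R ^+ 3 <= \sum_(i < n.+1) \sum_(j < n.+1) \sum_(k < n.+1) moment i j k.
Proof.
set N : R := n.+1%:R.
pose r (x : T) := \sum_(i < n.+1) tnth x i ^+ 2.
have N0 : 0 < N by rewrite ltr0n.
have Er : \int[eta]_x r x = N.
  transitivity (\int[eta]_x (\sum_(i < n.+1) 1 * tnth x i ^+ 2)).
    by apply: eq_Rintegral => x _; apply: eq_bigr => i _; rewrite mul1r.
  rewrite Rintegral_lincomb => [|i _]; last exact: dominated_sq.
  under eq_bigr do rewrite Rintegral_sq mulr1.
  by rewrite sumr_const card_ord.
have r3E x : r x ^+ 3 = \sum_(p : 'I_n.+1 * ('I_n.+1 * 'I_n.+1))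
    1 * mon p.1 p.2.1 p.2.2 x.
  rewrite -(pair_bigA _ (fun i p => 1 * mon i p.1 p.2 x)) /=.
  under eq_bigr => i _ do rewrite -(pair_bigA _ (fun j k => 1 * mon i j k x)) /=.
  rewrite 2!exprS expr1 /r big_distrl /=; apply: eq_bigr => i _.
  rewrite mulr_suml mulr_sumr; apply: eq_bigr => j _.
  rewrite !mulr_sumr; apply: eq_bigr => k _.
  by rewrite /mon mul1r mulrA.
have -> : \sum_(i < n.+1) \sum_(j < n.+1) \sum_(k < n.+1) moment i j k =
    \int[eta]_x (r x ^+ 3).
  under eq_Rintegral do rewrite r3E.
  rewrite Rintegral_lincomb => [|p _]; last exact: dominated_mon.
  rewrite -(pair_bigA _ (fun i p => 1 * moment i p.1 p.2)) /=.
  apply: eq_bigr => i _.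
  rewrite -(pair_bigA _ (fun j k => 1 * moment i j k)) /=.
  by apply: eq_bigr => j _; apply: eq_bigr => k _; rewrite mul1r.
have dr : dominated r.
  by apply: dominated_sum => i _; exact: dominated_sq.
have dr3 : dominated (fun x => r x ^+ 3).
  under eq_fun do rewrite r3E.
  by apply: dominated_sum => p _; apply: dominatedZ; exact: dominated_mon.
have d1 : dominated (fun=> - 2 * N ^+ 3).
  split; first exact: measurable_cst.
  exists `|- 2 * N ^+ 3| => x; rewrite ler_peMr// lerDl.
  by apply: sumr_ge0 => i _; rewrite exprn_even_ge0.
have -> : N ^+ 3 = \int[eta]_x (3 * N ^+ 2 * r x + - 2 * N ^+ 3).
  rewrite RintegralD//; last 2 first.
  - exact/dominated_integrable/dominatedZ.
  - exact: dominated_integrable.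
  rewrite RintegralZl//; last exact: dominated_integrable.
  rewrite Er Rintegral_cst// [X in fine X]probability_setT /=; ring.
apply: le_Rintegral_dominated => //.
  by apply: dominatedD => //; exact: dominatedZ.
move=> x; have r0 : 0 <= r x by apply: sumr_ge0 => i _; exact: sqr_ge0.
rewrite -subr_ge0.
have -> : r x ^+ 3 - (3 * N ^+ 2 * r x + - 2 * N ^+ 3) =
  (r x - N) ^+ 2 * (r x + 2 * N) by ring.
by rewrite mulr_ge0 ?sqr_ge0// addr_ge0// mulr_ge0// ltW.
Qed.

End moments.

Section even_primitive.
Variable R : realType.

Definition even_primitive (c0 c1 c2 c3 : R) : {poly R} :=
  c0 *: 'X + (c1 / 3) *: 'X^3 + (c2 / 5) *: 'X^5 + (c3 / 7) *: 'X^7.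

Lemma deriv_even_primitive c0 c1 c2 c3 a :
  (even_primitive c0 c1 c2 c3)^`().[a] =
  c0 + c1 * a ^+ 2 + c2 * a ^+ 4 + c3 * a ^+ 6.
Proof.
rewrite /even_primitive !derivD !derivZ derivX !derivXn -polyC1.
rewrite !(hornerD, hornerZ, hornerMn, hornerXn, hornerC).
by rewrite !succnK; field.
Qed.

Lemma horner_even_primitive c0 c1 c2 c3 a :
  (even_primitive c0 c1 c2 c3).[a] =
  c0 * a + c1 / 3 * a ^+ 3 + c2 / 5 * a ^+ 5 + c3 / 7 * a ^+ 7.
Proof. by rewrite /even_primitive !(hornerD, hornerZ, hornerXn, hornerX). Qed.

Lemma even_primitive_inc c0 c1 c2 c3 s :
  0 <= c0 * s + c1 / 3 * s ^+ 3 + c2 / 5 * s ^+ 5 + c3 / 7 * s ^+ 7 ->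
  (even_primitive c0 c1 c2 c3).[- s] <= (even_primitive c0 c1 c2 c3).[s].
Proof.
rewrite !horner_even_primitive => H; rewrite -subr_ge0.
set P := (X in 0 <= X) in H.
suff -> : c0 * s + c1 / 3 * s ^+ 3 + c2 / 5 * s ^+ 5 + c3 / 7 * s ^+ 7 -
  (c0 * - s + c1 / 3 * (- s) ^+ 3 + c2 / 5 * (- s) ^+ 5 + c3 / 7 * (- s) ^+ 7)
  = P + P by exact: addr_ge0.
by rewrite /P; field.
Qed.

End even_primitive.

Section conditional_moments.
Variables (R : realType) (n : nat) (eta : probability (n.+1.-tuple R) R).
Hypotheses (eta_inv : Hn_invariant eta) (eta_iso : isotropic eta).
Hypothesis eta_lc : log_concave eta.
Local Notation T := (n.+1.-tuple R).
Local Notation dominated_integrable := (dominated_integrable eta_inv eta_iso eta_lc).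

(** With x_j = X fixed, the coefficients make the average over x_0 in [-X, X] vanish,
so that the cube gives equality. *)
Definition cross (j k : 'I_n.+1) (x : T) : R :=
  (5 / 18 * tnth x ord0 ^+ 4 + 5 / 18 * tnth x j ^+ 4 -
   tnth x ord0 ^+ 2 * tnth x j ^+ 2) * tnth x k ^+ 2.

Lemma crossE j k x : cross j k x =
  5 / 18 * mon ord0 ord0 k x + 5 / 18 * mon j j k x - mon ord0 j k x.
Proof. by rewrite /cross /mon; field. Qed.

Lemma dominated_cross j k : dominated (cross j k).
Proof.
rewrite (_ : cross j k = fun x => 5 / 18 * mon ord0 ord0 k x +
    5 / 18 * mon j j k x + -1 * mon ord0 j k x); last first.
  by apply/funext => x; rewrite crossE mulN1r.
by do 2?apply: dominatedD; apply: dominatedZ; exact: dominated_mon.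
Qed.

(** On |x_0| <= |x_j| = X the primitive of (5/18) (y^4 + X^4) - X^2 y^2 in y is
s (X^2 - s^2) (5 X^2 - s^2) / 18, nonnegative for s <= X, so the expectation of
[cross] over this region is nonnegative.  Exchanging x_0 and x_j gives the other
region; on their common boundary [cross] is at most 0, so counting it twice is harmless. *)
Lemma moment_cross0 (j k : 'I_n) : j != k ->
  moment eta ord0 (lift ord0 j) (lift ord0 k) <=
  5 / 9 * moment eta ord0 ord0 (lift ord0 k).
Proof.
move=> jk; set j' := lift ord0 j; set k' := lift ord0 k.
have jk' : j' != k' by rewrite (inj_eq lift_inj).
have k0 : ord0 != k' by exact: neq_lift.
have [F [mF F0 dF _ etaF]] := even_density eta_inv.2 eta_lc.
pose W (x : T) : R := if `|tnth x ord0| <= `|tnth x j'| then 1 else 0.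
pose W' (x : T) : R := if `|tnth x j'| <= `|tnth x ord0| then 1 else 0.
have mW : measurable_fun setT W.
  apply: measurable_fun_ifT; [|exact: measurable_cst|exact: measurable_cst].
  by apply: measurable_fun_ler; apply: measurableT_comp => //; exact: measurable_tnth.
have mW' : measurable_fun setT W'.
  apply: measurable_fun_ifT; [|exact: measurable_cst|exact: measurable_cst].
  by apply: measurable_fun_ler; apply: measurableT_comp => //; exact: measurable_tnth.
have [mH [c Hc]] := dominated_cross j' k'.
have W01 x : 0 <= W x <= 1 by rewrite /W; case: ifP; rewrite !lexx ler01.
have W'01 x : 0 <= W' x <= 1 by rewrite /W'; case: ifP; rewrite !lexx ler01.
have dom (V : T -> R) : measurable_fun setT V -> (forall x, 0 <= V x <= 1) ->
    dominated (fun x => V x * cross j' k' x).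
  move=> mV V01; split; first exact: measurable_funM.
  exists c => x; apply: le_trans (Hc x); rewrite normrM.
  by case/andP: (V01 x) => V0 V1; rewrite ger0_norm// ler_piMl.
have WH : 0 <= Rintegral eta setT (fun x => W x * cross j' k' x).
  apply: (@unimodal_expectation _ _ _ _ mF F0 dF etaF _ _ (fun v =>
    even_primitive (5 / 18 * tnth v j ^+ 4 * tnth v k ^+ 2)
      (- (tnth v j ^+ 2 * tnth v k ^+ 2)) (5 / 18 * tnth v k ^+ 2) 0)) => //.
  - by move=> x; case/andP: (W01 x).
  - move=> v a b ab; rewrite /W !tnth_tconsS !tnth_tcons0.
    by case: ifP => [bv|_]; [rewrite (le_trans ab bv)|case: ifP].
  - move=> a v; rewrite deriv_even_primitive /cross !tnth_tconsS tnth_tcons0.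
    by ring.
  - move=> v s s0 sW; apply: even_primitive_inc.
    have sv : s <= `|tnth v j|.
      rewrite leNgt; apply/negP => vs.
      have /sW : `|(s + `|tnth v j|) / 2| < s.
        by rewrite ger0_norm ?divr_ge0 ?addr_ge0//; lra.
      rewrite /W tnth_tconsS tnth_tcons0 ger0_norm ?divr_ge0 ?addr_ge0//.
      by case: ifPn; rewrite ?ltxx// => + _; lra.
    set X := tnth v j; set z := tnth v k ^+ 2.
    have z0 : 0 <= z by exact: sqr_ge0.
    have sX : s ^+ 2 <= X ^+ 2.
      by rewrite -[X ^+ 2]real_normK ?num_real// ler_pXn2r ?nnegrE.
    have -> : 5 / 18 * X ^+ 4 * z * s + - (X ^+ 2 * z) / 3 * s ^+ 3 +
       5 / 18 * z / 5 * s ^+ 5 + 0 / 7 * s ^+ 7 =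
       z * s / 18 * ((X ^+ 2 - s ^+ 2) * (5 * X ^+ 2 - s ^+ 2)) by field.
    apply: mulr_ge0; first by rewrite divr_ge0// mulr_ge0.
    apply: mulr_ge0; first by rewrite subr_ge0.
    have := sqr_ge0 X; lra.
  - exact: dominated_integrable (dom _ mW W01).
have W'H : 0 <= Rintegral eta setT (fun x => W' x * cross j' k' x).
  have [mWH _] := dom _ mW W01.
  rewrite -(@Rintegral_invariant _ _ _ _ _ (@measurable_permute _ _ (tperm ord0 j'))
    (eta_inv.1 _) mWH) in WH.
  rewrite (_ : Rintegral _ _ _ = \int[eta]_x
    (W (permute (tperm ord0 j') x) * cross j' k' (permute (tperm ord0 j') x)))//.
  apply: eq_Rintegral => x _; rewrite /W /W' /cross !tnth_mktuple.
  rewrite tpermL tpermR tpermD//.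
  by congr (_ * _); ring.
have : 0 <= \int[eta]_x cross j' k' x.
  apply: (le_trans (addr_ge0 WH W'H)).
  rewrite -RintegralD//; try exact: dominated_integrable (dom _ _ _).
  apply: (le_Rintegral_dominated eta_inv eta_iso eta_lc).
  - by apply: dominatedD; exact: dom.
  - exact: dominated_cross.
  move=> x; rewrite /W /W'; have [xy|yx|xy] := ltgtP `|tnth x ord0| `|tnth x j'|.
  - by rewrite mul1r mul0r addr0.
  - by rewrite mul1r mul0r add0r.
  - rewrite mul1r gerDl /cross.
    have -> : tnth x j' ^+ 4 = (tnth x j' ^+ 2) ^+ 2 by ring.
    have -> : tnth x ord0 ^+ 4 = (tnth x ord0 ^+ 2) ^+ 2 by ring.
    have -> : tnth x j' ^+ 2 = tnth x ord0 ^+ 2.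
      by rewrite -[LHS]real_normK ?num_real// -xy real_normK ?num_real.
    apply: mulr_le0_ge0; last exact: sqr_ge0.
    have := sqr_ge0 (tnth x ord0 ^+ 2); lra.
have -> : \int[eta]_x cross j' k' x = 5 / 18 * moment eta ord0 ord0 k' +
    5 / 18 * moment eta j' j' k' + -1 * moment eta ord0 j' k'.
  have E a b e d : d * moment eta a b e = \int[eta]_x (d * mon a b e x).
    by rewrite RintegralZl//; exact: dominated_integrable (dominated_mon _ _ _ _).
  have D a b e d : dominated (fun x : T => d * mon a b e x).
    exact/dominatedZ/dominated_mon.
  rewrite !E -!RintegralD//; try exact: dominated_integrable.
    by apply: eq_Rintegral => x _; rewrite crossE mulN1r.
  by apply: dominated_integrable; exact: dominatedD.
have -> : moment eta j' j' k' = moment eta ord0 ord0 k'.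
  rewrite -(moment_permute eta_inv (tperm ord0 j') j' j' k') tpermR tpermD//.
lra.
Qed.

(** For u = s^2 and T = t sum_j x_j^2 fixed, the average of x^2 (a x^2 + T)^2 over
[-s, s] is (u / 3) (T + 3 a u / 5)^2 + (4 / 175) a^2 u^3, and the tangent
u^3 >= 27 u - 54 at u = 3, the value of u for the uniform law of variance 1, bounds
it below by the average of (108 / 175) a^2 (3 x^2 - 2). *)
Lemma Rintegral_head_form a t :
  108 / 175 * a ^+ 2 <= \int[eta]_x (tnth x ord0 ^+ 2 *
    (a * tnth x ord0 ^+ 2 + t * \sum_(j < n) tnth x (lift ord0 j) ^+ 2) ^+ 2).
Proof.
have [F [mF F0 dF _ etaF]] := even_density eta_inv.2 eta_lc.
pose S (x : T) := \sum_(j < n) tnth x (lift ord0 j) ^+ 2.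
pose Q (x : T) := tnth x ord0 ^+ 2 * (a * tnth x ord0 ^+ 2 + t * S x) ^+ 2.
have mX i (d : nat) : measurable_fun setT (fun x : T => tnth x i ^+ d).
  exact: (@measurable_coordX R n i d).
have mS : measurable_fun setT S by apply: measurable_sum => j; exact: (mX (lift ord0 j) 2).
have mQ : measurable_fun setT Q.
  apply: measurable_funM; first exact: (mX ord0 2).
  apply: measurable_funX; apply: measurable_funD.
    by apply: measurable_funM => //; exact: (mX ord0 2).
  exact: measurable_funM.
have dQ : dominated Q.
  apply: (@dominated_le _ _ _ 6) => //.
  exists ((`|a| + `|t| * n%:R) ^+ 2); first exact: sqr_ge0.
  move=> x m m0 xm.
  have X2 i : tnth x i ^+ 2 <= m ^+ 2.
    by rewrite -[tnth x i ^+ 2]real_normK ?num_real// ler_pXn2r ?nnegrE.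
  rewrite /Q ger0_norm; last by apply: mulr_ge0; exact: sqr_ge0.
  have -> : (`|a| + `|t| * n%:R) ^+ 2 * m ^+ 6 =
    m ^+ 2 * ((`|a| + `|t| * n%:R) * m ^+ 2) ^+ 2 by ring.
  apply: ler_pM => //; [exact: sqr_ge0|exact: sqr_ge0|].
  rewrite -[leLHS]real_normK ?num_real// ler_pXn2r ?nnegrE//; last first.
    by rewrite mulr_ge0 ?sqr_ge0// addr_ge0// mulr_ge0.
  apply: le_trans (ler_normD _ _) _; rewrite mulrDl !normrM; apply: lerD.
    by rewrite ler_wpM2l// -normrM -expr2 ger0_norm ?sqr_ge0.
  rewrite -mulrA ler_wpM2l// ger0_norm; last by apply: sumr_ge0 => j _; exact: sqr_ge0.
  apply: (@le_trans _ _ (\sum_(j < n) m ^+ 2)); first exact: ler_sum.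
  by rewrite sumr_const card_ord mulr_natl.
pose H (x : T) := Q x + (- (108 / 175 * a ^+ 2 * 3) * tnth x ord0 ^+ 2 +
  (108 / 175 * a ^+ 2 * 2)).
have dcst (e : R) : dominated (fun _ : T => e).
  split; first exact: measurable_cst.
  exists `|e| => y; rewrite ler_peMr// lerDl.
  by apply: sumr_ge0 => i _; rewrite exprn_even_ge0.
have dsq := dominatedZ (- (108 / 175 * a ^+ 2 * 3)) (@dominated_sq R n ord0).
have dlow := dominatedD dsq (dcst (108 / 175 * a ^+ 2 * 2)).
have dH : dominated H := dominatedD dQ dlow.
have : 0 <= Rintegral eta setT (fun x => 1 * H x).
  apply: (@unimodal_expectation _ _ _ _ mF F0 dF etaF (fun=> 1) H (fun v =>
    let T := t * \sum_(j < n) tnth v j ^+ 2 in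
    even_primitive (108 / 175 * a ^+ 2 * 2) (T ^+ 2 - 108 / 175 * a ^+ 2 * 3)
      (2 * a * T) (a ^+ 2))) => //.
  - by move=> _ x y _.
  - exact: dH.1.
  - move=> b v; rewrite deriv_even_primitive /H /Q /S tnth_tcons0.
    under eq_bigr do rewrite tnth_tconsS.
    by ring.
  - move=> v s s0 _; apply: even_primitive_inc; set T := t * _.
    have -> : 108 / 175 * a ^+ 2 * 2 * s + (T ^+ 2 - 108 / 175 * a ^+ 2 * 3) / 3 * s ^+ 3 +
      2 * a * T / 5 * s ^+ 5 + a ^+ 2 / 7 * s ^+ 7 =
      s * (s ^+ 2 / 3 * (T + 3 / 5 * a * s ^+ 2) ^+ 2 +
        4 / 175 * a ^+ 2 * ((s ^+ 2 - 3) ^+ 2 * (s ^+ 2 + 6))) by field.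
    apply: mulr_ge0 => //; apply: addr_ge0.
      by rewrite mulr_ge0 ?sqr_ge0// divr_ge0// sqr_ge0.
    rewrite mulr_ge0//; first by rewrite mulr_ge0// sqr_ge0.
    by rewrite mulr_ge0 ?sqr_ge0// addr_ge0// sqr_ge0.
  - under eq_fun do rewrite mul1r.
    exact: dominated_integrable.
under eq_Rintegral do rewrite mul1r.
rewrite RintegralD//; [|exact: dominated_integrable|]; last first.
  by apply: dominated_integrable; apply: dominatedD.
rewrite RintegralD//; [|exact: dominated_integrable..].
rewrite RintegralZl//; last exact: dominated_integrable (@dominated_sq R n ord0).
rewrite Rintegral_sq// Rintegral_cst// [X in fine X]probability_setT /=.
rewrite /Q /S; lra.
Qed.

End conditional_moments.

(** * The quadratic form of one parity class *)

(** The hypothesis [head] is the bound for n equal coefficients t, used at t = S / n.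
Either
S^2 <= 64 K^2 a^2, and equalizing the coefficients changes the form by at most
(p - q) S^2 / n = O(a^2 / n); or S^2 is so large that q S^2 absorbs both the mixed
term and (108 / 175) a^2. *)
Lemma quadratic_form_bound (R : realFieldType) (n K M p q a S b2 : R) :
  1 <= n -> 1 <= K -> 6 * K <= n + 1 ->
  M <= K -> 0 <= M -> p <= K -> q <= p -> 9 / 5 * q <= p ->
  1 - 3 * K / (n + 1) <= q ->
  (forall t, 108 / 175 * a ^+ 2 <=
     M * a ^+ 2 + 2 * p * a * (n * t) + (p - q) * (n * t ^+ 2) + q * (n * t) ^+ 2) ->
  S ^+ 2 <= n * b2 ->
  (108 / 175 - 128 * K ^+ 3 / (n + 1)) * (a ^+ 2 + b2) <=
  M * a ^+ 2 + 2 * p * a * S + (p - q) * b2 + q * S ^+ 2.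
Proof.
move=> n1 K1 Kn MK M0 pK qp pq q1 head Sb.
have N0 : 0 < n + 1 by lra.
have n0 : 0 < n by lra.
pose d := (n + 1)^-1.
have d0 : 0 < d by rewrite invr_gt0.
have dK : 6 * K * d <= 1 by rewrite ler_pdivrMr// mul1r.
have b0 : 0 <= b2.
  by rewrite -(pmulr_rge0 _ n0); apply: le_trans Sb; exact: sqr_ge0.
rewrite -/d in q1 *.
have qh : 1 / 2 <= q by nra.
have K3 : K <= K ^+ 3.
  by have : 1 <= K ^+ 2 by [rewrite exprn_ege1|]; nra.
have a0 := sqr_ge0 a.
have pb : (108 / 175 - 128 * K ^+ 3 * d) * b2 <= (p - q) * b2.
  by apply: ler_wpM2r => //; nra.
have [SL|SL] := leP (S ^+ 2) (64 * K ^+ 2 * a ^+ 2).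
  have := head (S / n).
  have -> : n * (S / n) = S by rewrite mulrC divfK// gt_eqF.
  have -> : n * (S / n) ^+ 2 = S ^+ 2 / n by field; rewrite gt_eqF.
  move=> hd.
  have Sn : S ^+ 2 / n <= 128 * K ^+ 2 * d * a ^+ 2.
    rewrite ler_pdivrMr//.
    have nd : 1 / 2 <= d * n.
      rewrite /d [leRHS]mulrC ler_pdivlMr//; lra.
    have : 0 <= K ^+ 2 * a ^+ 2 by rewrite mulr_ge0 ?sqr_ge0.
    set Z := K ^+ 2 * a ^+ 2 => Z0.
    have -> : 128 * K ^+ 2 * d * a ^+ 2 * n = 128 * (d * n) * Z by rewrite /Z; ring.
    have := SL; have -> : 64 * K ^+ 2 * a ^+ 2 = 64 * Z by rewrite /Z; ring.
    nra.
  have Sn0 : 0 <= S ^+ 2 / n by rewrite divr_ge0 ?sqr_ge0// ltW.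
  have pS : (p - q) * (S ^+ 2 / n) <= 128 * K ^+ 3 * d * a ^+ 2.
    apply: (@le_trans _ _ (K * (S ^+ 2 / n))); first by apply: ler_wpM2r => //; lra.
    apply: (@le_trans _ _ (K * (128 * K ^+ 2 * d * a ^+ 2))).
      by apply: ler_wpM2l => //; lra.
    by rewrite le_eqVlt; apply/orP; left; apply/eqP; ring.
  rewrite mulrDr; lra.
(* here the mixed term is absorbed by q S^2 *)
have aS : 2 * p * a * S >= - (S ^+ 2 / 4).
  have : 8 * K * (a * S) >= - S ^+ 2 /\ 8 * K * (a * S) <= S ^+ 2.
    have X : (8 * K * a) ^+ 2 <= S ^+ 2.
      rewrite le_eqVlt; apply/orP; right; apply: le_lt_trans SL.
      by rewrite le_eqVlt; apply/orP; left; apply/eqP; ring.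
    by split; [have := sqr_ge0 (8 * K * a + S)|have := sqr_ge0 (8 * K * a - S)]; lra.
  move=> [lo hi].
  have p0 : 0 <= p by lra.
  have [as0|as0] := leP 0 (a * S).
    have : 0 <= 2 * p * (a * S) by rewrite mulr_ge0// mulr_ge0.
    have := sqr_ge0 S; lra.
  have : 2 * K * (a * S) <= 2 * p * (a * S) by apply: ler_wnM2r; lra.
  lra.
have S2 : 16 * a ^+ 2 <= S ^+ 2 / 4.
  have : a ^+ 2 <= K ^+ 2 * a ^+ 2 by rewrite ler_peMl// exprn_ege1.
  lra.
have qS : 1 / 2 * S ^+ 2 <= q * S ^+ 2 by apply: ler_wpM2r => //; exact: sqr_ge0.
have Ma : 0 <= M * a ^+ 2 by rewrite mulr_ge0.
have da : 0 <= 128 * K ^+ 3 * d * a ^+ 2.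
  apply: mulr_ge0 => //; apply: mulr_ge0; last exact: ltW.
  by apply: mulr_ge0 => //; apply: exprn_ge0; lra.
rewrite mulrDr; lra.
Qed.

Section moment_form.
Variables (R : realType) (n : nat) (eta : probability (n.+1.-tuple R) R).
Hypotheses (eta_inv : Hn_invariant eta) (eta_iso : isotropic eta).
Hypothesis eta_lc : log_concave eta.
Local Notation T := (n.+1.-tuple R).
Implicit Types i j k : 'I_n.+1.
Local Notation moment := (moment eta).

Lemma momentC12 i j k : moment i j k = moment j i k.
Proof. by apply: eq_Rintegral => x _; rewrite /mon; ring. Qed.

Lemma momentC23 i j k : moment i j k = moment i k j.
Proof. by apply: eq_Rintegral => x _; rewrite /mon; ring. Qed.

Lemma tperm_neq i i' j : i != j -> tperm i i' j != i'.
Proof.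
by move=> ij; rewrite -[X in _ != X](tpermL i i') (inj_eq perm_inj) eq_sym.
Qed.

Lemma moment1_eq i i' : moment i i i = moment i' i' i'.
Proof. by rewrite -(moment_permute eta_inv (tperm i i')) tpermL. Qed.

Lemma moment2_eq i j i' j' : i != j -> i' != j' -> moment i i j = moment i' i' j'.
Proof.
move=> ij ij'; rewrite -(moment_permute eta_inv (tperm i i') i i j) tpermL.
set l := tperm i i' j.
have il : l != i' by exact: tperm_neq.
rewrite -(moment_permute eta_inv (tperm l j') i' i' l) tpermL.
by rewrite tpermD// eq_sym.
Qed.

Lemma moment3_eq i j k i' j' k' : i != j -> i != k -> j != k ->
  i' != j' -> i' != k' -> j' != k' -> moment i j k = moment i' j' k'.
Proof.
move=> ij ik jk ij' ik' jk'.
rewrite -(moment_permute eta_inv (tperm i i') i j k) tpermL.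
set l := tperm i i' j; set m := tperm i i' k.
have il : l != i' by exact: tperm_neq.
have im : m != i' by exact: tperm_neq.
have lm : l != m by rewrite (inj_eq perm_inj).
rewrite -(moment_permute eta_inv (tperm l j') i' l m) tpermL tpermD//; last first.
  by rewrite eq_sym.
set o := tperm l j' m.
have oi : o != i'.
  have -> : i' = tperm l j' i' by rewrite tpermD// eq_sym.
  by rewrite (inj_eq perm_inj).
have oj : o != j' by exact: tperm_neq.
rewrite -(moment_permute eta_inv (tperm o k') i' j' o) tpermL !tpermD//.
- by rewrite eq_sym.
- by rewrite eq_sym.
Qed.

Hypothesis n2 : (2 <= n)%N.
Let i0 : 'I_n.+1 := ord0.
Let i1 : 'I_n.+1 := lift ord0 (Ordinal (ltnW n2)).
Let i2 : 'I_n.+1 := lift ord0 (Ordinal n2).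
Let i01 : i0 != i1. Proof. by []. Qed.
Let i02 : i0 != i2. Proof. by []. Qed.
Let i12 : i1 != i2. Proof. by []. Qed.

Let M := moment i0 i0 i0.
Let p := moment i0 i0 i1.
Let q := moment i0 i1 i2.
Let K := sixth_bound R.

(** The coefficients solve M, p, p, p, q for the five patterns of equalities
among i, j, k. *)
Lemma moment_pattern i j k : moment i j k =
  q + (p - q) * (j == k)%:R + (p - q) * (j == i)%:R + (p - q) * (k == i)%:R +
  (M - 3 * p + 2 * q) * (j == i)%:R * (k == i)%:R.
Proof.
have [->{j}|ji] := eqVneq j i; last first.
  have [<-{k}|jk] := eqVneq j k.
    rewrite (negbTE ji) momentC12 momentC23 (moment2_eq ji i01) -/p /=; ring.
  have [->{k jk}|ki] := eqVneq k i.
    rewrite momentC23 (moment2_eq _ i01) 1?eq_sym// -/p /=; ring.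
  rewrite (@moment3_eq i j k i0 i1 i2)// -/q 1?eq_sym// /=; ring.
have [<-{k}|ik] := eqVneq i k.
  rewrite (moment1_eq i i0) -/M /=; ring.
rewrite (moment2_eq ik i01) -/p /=; ring.
Qed.

Lemma sum_moment_form i (B : 'I_n.+1 -> R) :
  \sum_j \sum_k B j * B k * moment i j k =
  q * (\sum_j B j) ^+ 2 + (p - q) * \sum_j B j ^+ 2 +
  2 * (p - q) * B i * (\sum_j B j) + (M - 3 * p + 2 * q) * B i ^+ 2.
Proof.
set S := \sum_j B j.
have inner j : \sum_k B j * B k * moment i j k =
   q * B j * S + (p - q) * B j ^+ 2 + (p - q) * (j == i)%:R * B j * S +
   (p - q) * B j * B i + (M - 3 * p + 2 * q) * (j == i)%:R * B j * B i.
  under eq_bigr do rewrite moment_pattern.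
  transitivity (\sum_k (q * B j * B k + (p - q) * B j * (if k == j then B k else 0) +
      (p - q) * (j == i)%:R * B j * B k +
      (p - q) * B j * (if k == i then B k else 0) +
      (M - 3 * p + 2 * q) * (j == i)%:R * B j * (if k == i then B k else 0))).
    apply: eq_bigr => k _; rewrite (eq_sym j k).
    by case: (k == j); case: (k == i) => /=; ring.
  rewrite !big_split /= -!mulr_sumr -!big_mkcond /= !big_pred1_eq -/S; ring.
under eq_bigr do rewrite inner.
transitivity (\sum_j (q * S * B j + (p - q) * B j ^+ 2 +
    (p - q) * S * (if j == i then B j else 0) + (p - q) * B i * B j +
    (M - 3 * p + 2 * q) * B i * (if j == i then B j else 0))).
  by apply: eq_bigr => j _; case: (j == i) => /=; ring.
rewrite !big_split /= -!mulr_sumr -!big_mkcond /= !big_pred1_eq -/S; ring.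
Qed.

Lemma Rintegral_form i (B : 'I_n.+1 -> R) :
  \int[eta]_x (tnth x i ^+ 2 * (\sum_j B j * tnth x j ^+ 2) ^+ 2) =
  \sum_j \sum_k B j * B k * moment i j k.
Proof.
transitivity (\int[eta]_x (\sum_(l : 'I_n.+1 * 'I_n.+1)
    B l.1 * B l.2 * mon i l.1 l.2 x)).
  apply: eq_Rintegral => x _.
  rewrite -(pair_bigA _ (fun j k => B j * B k * mon i j k x)) /=.
  rewrite [(\sum_j _) ^+ 2]expr2 mulr_suml mulr_sumr; apply: eq_bigr => j _.
  rewrite !mulr_sumr; apply: eq_bigr => k _; rewrite /mon; ring.
rewrite (Rintegral_lincomb eta_inv eta_iso eta_lc) => [|l _]; last exact: dominated_mon.
by rewrite -(pair_bigA _ (fun j k => B j * B k * moment i j k)).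
Qed.

Lemma moment_head_form a t : 108 / 175 * a ^+ 2 <=
  M * a ^+ 2 + 2 * p * a * (n%:R * t) + (p - q) * (n%:R * t ^+ 2) +
  q * (n%:R * t) ^+ 2.
Proof.
apply: le_trans (Rintegral_head_form eta_inv eta_iso eta_lc a t) _.
pose B j := if j == i0 then a else t.
rewrite (_ : Rintegral _ _ _ =
  \int[eta]_x (tnth x i0 ^+ 2 * (\sum_j B j * tnth x j ^+ 2) ^+ 2)); last first.
  apply: eq_Rintegral => x _; congr (_ * _ ^+ 2).
  by rewrite big_ord_recl /B /= mulr_sumr.
rewrite Rintegral_form sum_moment_form.
have sB (f : R -> R) : \sum_j f (B j) = f a + n%:R * f t.
  rewrite big_ord_recl /B /=; congr (_ + _).
  by rewrite sumr_const card_ord mulr_natl.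
rewrite (sB id) (sB (fun z => z ^+ 2)) /B eqxx.
by rewrite le_eqVlt; apply/orP; left; apply/eqP => /=; ring.
Qed.

Lemma moment_q_ge : 1 - 3 * K / n.+1%:R <= q.
Proof.
have N0 : 0 < n.+1%:R :> R by rewrite ltr0n.
have := sum_moments_ge eta_inv eta_iso eta_lc.
have inner i : \sum_j \sum_k moment i j k =
    q * n.+1%:R ^+ 2 + (p - q) * n.+1%:R + 2 * (p - q) * n.+1%:R + (M - 3 * p + 2 * q).
  have := sum_moment_form i (fun=> 1).
  under eq_bigr do under eq_bigr do rewrite mulr1 mul1r.
  move=> ->; rewrite expr1n !mulr1.
  by rewrite !sumr_const card_ord.
under eq_bigr do rewrite inner.
rewrite sumr_const card_ord -[X in _ <= X]mulr_natl exprS ler_pM2l//.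
set N := n.+1%:R => le.
have pK : p <= K.
  apply: le_trans (moment_sixth eta_inv eta_iso eta_lc i0).
  exact: moment_le_sixth.
have MK : M <= K by exact: moment_sixth.
have q0 : 0 <= q by exact: moment_ge0.
have N1 : 1 <= N by rewrite ler1n.
suff : (1 - 3 * K / N) * N ^+ 2 <= q * N ^+ 2 by rewrite ler_pM2r ?exprn_gt0.
have -> : (1 - 3 * K / N) * N ^+ 2 = N ^+ 2 - 3 * K * N by field; rewrite gt_eqF.
have K1 : 1 <= K := sixth_bound_ge1 R.
nra.
Qed.

Lemma moment_cross : q <= 5 / 9 * p.
Proof.
have := @moment_cross0 _ _ _ eta_inv eta_iso eta_lc
  (Ordinal (ltnW n2)) (Ordinal n2) isT.
by rewrite -/i1 -/i2 -/q (moment2_eq i02 i01).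
Qed.

Lemma moment_form_bound i (B : 'I_n.+1 -> R) : 6 * K <= n.+1%:R ->
  (108 / 175 - 128 * K ^+ 3 / n.+1%:R) * \sum_j B j ^+ 2 <=
  \sum_j \sum_k B j * B k * moment i j k.
Proof.
move=> KN.
pose b2 := \sum_(j | j != i) B j ^+ 2.
pose S := \sum_(j | j != i) B j.
have n1 : (0 < n)%N by exact: ltnW.
have nE : n.+1%:R = n%:R + 1 :> R by rewrite -natr1.
have q0 : 0 <= q by exact: moment_ge0.
have pq := moment_cross.
have cs : S ^+ 2 <= n%:R * b2.
  have card : \sum_(j < n.+1 | j != i) 1 = n%:R :> R.
    by rewrite sumr_const cardC1 card_ord.
  have n0 : 0 < n%:R :> R by rewrite ltr0n.
  have : 0 <= \sum_(j | j != i) (n%:R * B j - S) ^+ 2.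
    by apply: sumr_ge0 => j _; exact: sqr_ge0.
  have -> : \sum_(j | j != i) (n%:R * B j - S) ^+ 2 =
      n%:R * (n%:R * b2 - S ^+ 2).
    transitivity (\sum_(j | j != i) (n%:R ^+ 2 * B j ^+ 2 + - 2 * n%:R * S * B j +
        S ^+ 2 * 1)).
      by apply: eq_bigr => j _; ring.
    rewrite !big_split /= -!mulr_sumr card -/S -/b2; ring.
  by rewrite pmulr_rge0// subr_ge0.
have sumS : \sum_j B j = B i + S by rewrite (bigD1 i).
have sumb : \sum_j B j ^+ 2 = B i ^+ 2 + b2 by rewrite (bigD1 i).
rewrite sum_moment_form sumS sumb nE.
have -> : q * (B i + S) ^+ 2 + (p - q) * (B i ^+ 2 + b2) +
    2 * (p - q) * B i * (B i + S) + (M - 3 * p + 2 * q) * B i ^+ 2 =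
  M * B i ^+ 2 + 2 * p * B i * S + (p - q) * b2 + q * S ^+ 2 by ring.
apply: quadratic_form_bound => //.
- by rewrite ler1n.
- exact: sixth_bound_ge1.
- by rewrite -nE.
- exact: moment_sixth.
- exact: moment_ge0.
- apply: le_trans (moment_sixth eta_inv eta_iso eta_lc i0).
  exact: moment_le_sixth.
- lra.
- lra.
- by rewrite -nE; exact: moment_q_ge.
- by move=> t; exact: moment_head_form.
Qed.

End moment_form.

(** * Cubic monomials and their parity classes *)

Section cubic_monomials.
Variables (R : realType) (n : nat).
Local Notation T := (n.+1.-tuple R).
Local Notation index := (bmultinom n.+1 4).
Implicit Types (m : index) (x : T) (P : {set 'I_n.+1}).

Definition monomial m (x : T) : R := \prod_i tnth x i ^+ m i.

Lemma meval_cubic (f : mpoly n.+1 R) x : f \is @ishomog1 n.+1 R 3 mdeg ->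
  meval (tnth x) f = \sum_(m : index | mdeg m == 3%N) mcoeff m f * monomial m x.
Proof.
move=> hf; have sf : (msize f <= 4)%N.
  rewrite msizeE; apply/bigmax_leqP_seq => m mf _.
  by move/dhomogP : hf => /(_ m mf) ->.
rewrite {1}(mpolywE sf) raddf_sum /= [RHS]big_mkcond /=.
apply: eq_bigr => m _; rewrite mevalZ mevalX; case: ifPn => // m3.
by rewrite (dhomog_nemf_coeff hf m3) mul0r.
Qed.

Definition odd_part m : {set 'I_n.+1} := [set i | odd (m i)].

Lemma monomial_reflect i m x : monomial m (reflect_coord i x) =
  (-1) ^+ (i \in odd_part m) * monomial m x.
Proof.
rewrite /monomial (bigD1 i)//= [in RHS](bigD1 i)//= tnth_mktuple eqxx.
rewrite [(- tnth x i) ^+ _]exprNn inE signr_odd mulrA; congr (_ * _ * _); apply: eq_bigr => j ji.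
by rewrite tnth_mktuple (negbTE ji).
Qed.

Definition half_mnm m : multinom n.+1 := Multinom [tuple (m l)./2 | l < n.+1].

(** Each exponent is its parity plus twice its half. *)
Lemma cubic_degree m : mdeg m = 3%N -> (#|odd_part m| + 2 * mdeg (half_mnm m) = 3)%N.
Proof.
move=> <-; rewrite !mdegE -sum1_card big_mkcond /= big_distrr /= -big_split /=.
apply: eq_bigr => i _; rewrite inE multinomE tnth_mktuple.
rewrite -[in RHS](odd_double_half (m i)) -muln2 [(2 * _)%N]mulnC.
by case: (odd (m i)).
Qed.

Lemma cubic_proof (i j : 'I_n.+1) : (mdeg (mnm_add (mnm1 i) (mnm_muln (mnm1 j) 2)) < 4)%N.
Proof. by rewrite mdegD mdegMn !mdeg1. Qed.

Definition cubic (i j : 'I_n.+1) : index := BMultinom (cubic_proof i j).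

Lemma cubicE i j l : cubic i j l = ((i == l) + (j == l) * 2)%N.
Proof. by rewrite mnmDE mulmnE !mnm1E. Qed.

Lemma mdeg_cubic i j : mdeg (cubic i j) = 3%N.
Proof. by rewrite mdegD mdegMn !mdeg1. Qed.

Lemma odd_part_cubic i j : odd_part (cubic i j) = [set i]%SET.
Proof.
apply/setP => l; rewrite !inE cubicE oddD oddM andbF addbF eq_sym.
by case: eqP.
Qed.

Lemma cubic_inj i : injective (cubic i).
Proof.
move=> j k /(congr1 (fun m : index => m j)); rewrite !cubicE eqxx.
by move/eqP; rewrite eqn_add2l; case: (eqVneq k j) => [->//|].
Qed.

(** With one odd exponent, the halves of the exponents sum to 1. *)
Lemma cubic_surj i m : mdeg m = 3%N -> odd_part m = [set i]%SET -> exists j, m = cubic i j.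
Proof.
move=> m3 mi; have := cubic_degree m3; rewrite mi cards1 => h1.
have /mdeg1P[j /eqP hj] : mdeg (half_mnm m) == 1%N by apply/eqP; lia.
exists j; apply/val_inj/mnmP => l; rewrite [RHS]cubicE.
have := congr1 (fun h : multinom n.+1 => h l) hj.
rewrite multinomE tnth_mktuple mnm1E => <-.
rewrite -[LHS](odd_double_half (m l)) -muln2; congr (_ + _)%N.
by move/setP/(_ l) : mi; rewrite !inE => ->; rewrite eq_sym.
Qed.

Lemma monomial_cubic i j x : monomial (cubic i j) x = tnth x i * tnth x j ^+ 2.
Proof.
rewrite /monomial; under eq_bigr do rewrite cubicE exprD.
rewrite big_split /=; congr (_ * _).
- rewrite (bigD1 i)//= eqxx expr1 big1 ?mulr1// => l li.
  by rewrite eq_sym (negbTE li).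
- rewrite (bigD1 j)//= eqxx big1 ?mulr1// => l lj.
  by rewrite eq_sym (negbTE lj).
Qed.

Lemma multilinear_val m l : mdeg m = 3%N -> #|odd_part m| = 3%N ->
  m l = (l \in odd_part m) :> nat.
Proof.
move=> m3 c3; have := cubic_degree m3; rewrite c3 => h.
have /eqP : (mdeg (half_mnm m) = 0)%N by lia.
rewrite mdegE sum_nat_eq0 => /forallP/(_ l)/=.
rewrite multinomE tnth_mktuple => /eqP hl.
by rewrite inE -[LHS](odd_double_half (m l)) hl addn0.
Qed.

Lemma multilinear_inj m m' : mdeg m = 3%N -> mdeg m' = 3%N ->
  #|odd_part m| = 3%N -> odd_part m' = odd_part m -> m' = m.
Proof.
move=> m3 m3' c3 mm; apply/val_inj/mnmP => l /=.
by rewrite !multilinear_val// mm.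
Qed.

Lemma monomial_multilinear m : mdeg m = 3%N -> #|odd_part m| = 3%N ->
  exists i j k, [/\ i != j, i != k, j != k &
    forall x, monomial m x = tnth x i * tnth x j * tnth x k].
Proof.
move=> m3 c3; have := c3; rewrite cardE.
have := enum_uniq (mem (odd_part m)).
case E : (enum (odd_part m)) => [|i [|j [|k []]]]//=.
rewrite !inE negb_or => /andP[/andP[ij ik] /andP[jk _]] _.
exists i, j, k; split => // x; rewrite /monomial.
under eq_bigr do rewrite multilinear_val//.
transitivity (\prod_(l in odd_part m) tnth x l).
  by rewrite [RHS]big_mkcond; apply: eq_bigr => l _; case: (l \in odd_part m).
rewrite -big_enum E !big_cons big_nil /=.
by ring.
Qed.

Lemma monomial_le m x c : 0 <= c -> (forall i, `|tnth x i| <= c) ->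
  `|monomial m x| <= c ^+ mdeg m.
Proof.
move=> c0 xc; rewrite normr_prod mdegE -prodrXr.
apply: ler_prod => i _; rewrite normr_ge0 normrX /=.
by apply: lerXn2r; rewrite ?nnegrE.
Qed.

Lemma measurable_monomial m : measurable_fun setT (monomial m).
Proof.
by apply: measurable_prod => i _; exact: measurable_coordX.
Qed.

Lemma dominated_monomialM m m' : mdeg m = 3%N -> mdeg m' = 3%N ->
  dominated (fun x => monomial m x * monomial m' x).
Proof.
move=> m3 m3'; apply: (@dominated_le _ _ _ 6) => //.
  by apply: measurable_funM; exact: measurable_monomial.
exists 1 => // x c c0 xc; rewrite mul1r normrM (exprD c 3 3).
by apply: ler_pM => //; [rewrite -[3%N in leRHS]m3|rewrite -[3%N in leRHS]m3']; exact: monomial_le.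
Qed.

End cubic_monomials.

(** * The second moment of a cubic form *)

Section second_moment_of_cubic.
Variables (R : realType) (n : nat) (eta : probability (n.+1.-tuple R) R).
Hypotheses (eta_inv : Hn_invariant eta) (eta_iso : isotropic eta).
Hypothesis eta_lc : log_concave eta.
Local Notation T := (n.+1.-tuple R).
Local Notation index := (bmultinom n.+1 4).
Implicit Types (m : index) (P : {set 'I_n.+1}).
Local Notation K := (sixth_bound R).

Definition gram m m' : R := \int[eta]_x (monomial m x * monomial m' x).

(** Reflecting a coordinate in which the parities differ changes the sign of the
product of the two monomials. *)
Lemma gram_parity m m' : mdeg m = 3%N -> mdeg m' = 3%N ->
  odd_part m != odd_part m' -> gram m m' = 0.
Proof.
move=> m3 m3' mm'.
have [i im] : exists i, (i \in odd_part m) != (i \in odd_part m').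
  apply/existsP; apply: contraNT mm' => /existsPn H.
  by apply/eqP/setP => i; apply/eqP; have := H i; rewrite negbK.
have dm := dominated_monomialM R m3 m3'.
have [mm _] := dm.
have : gram m m' = - gram m m'.
  rewrite {1}/gram -(@Rintegral_invariant _ _ _ _ _ (@measurable_reflect_coord _ _ i)
    (eta_inv.2 i) mm) -mulN1r -RintegralZl//; last first.
    exact: dominated_integrable dm.
  apply: eq_Rintegral => x _; rewrite !monomial_reflect.
  move: im; case: (i \in _); case: (i \in _) => //= _; ring.
lra.
Qed.

Definition parity_class P m := (mdeg m == 3%N) && (odd_part m == P).

(** The odd part of a cubic monomial has one or three elements, so a class is empty,
or indexed by the squared variable, or a singleton. *)
Lemma parity_class_bound (alpha : index -> R) P : (2 <= n)%N -> 6 * K <= n.+1%:R ->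
  (108 / 175 - 128 * K ^+ 3 / n.+1%:R) * \sum_(m | parity_class P m) alpha m ^+ 2 <=
  \sum_(m | parity_class P m) \sum_(m' | parity_class P m')
    alpha m * alpha m' * gram m m'.
Proof.
move=> n2 KN.
have empty : (forall m, ~~ parity_class P m) ->
  (108 / 175 - 128 * K ^+ 3 / n.+1%:R) * \sum_(m | parity_class P m) alpha m ^+ 2 <=
  \sum_(m | parity_class P m) \sum_(m' | parity_class P m')
    alpha m * alpha m' * gram m m'.
  by move=> e; rewrite !big_pred0 ?mulr0// => m; exact/negbTE.
have [c1|c1] := eqVneq #|P| 1%N.
  have /cards1P[i Pi] : #|P| == 1%N by rewrite c1.
  have bij : {on [pred m | parity_class P m], bijective (cubic i)}.
    exists (fun m => odflt i [pick j | cubic i j == m]) => [j _|m].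
      by case: pickP => [k /eqP/cubic_inj|/(_ j)]//=; rewrite eqxx.
    rewrite inE => /andP[/eqP m3 /eqP mP].
    have [j ->] := cubic_surj m3 (etrans mP Pi).
    by case: pickP => [k /eqP|/(_ j)]//=; rewrite eqxx.
  have cl j : parity_class P (cubic i j).
    by rewrite /parity_class mdeg_cubic odd_part_cubic Pi !eqxx.
  rewrite !(reindex (cubic i))//=.
  under eq_bigl do rewrite cl.
  under [leRHS]eq_bigl do rewrite cl.
  have := moment_form_bound eta_inv eta_iso eta_lc n2 i (fun j => alpha (cubic i j)) KN.
  move=> /le_trans; apply.
  rewrite le_eqVlt; apply/orP; left; apply/eqP; apply: eq_bigr => j _.
  rewrite (reindex (cubic i))//=; under [RHS]eq_bigl do rewrite cl.
  apply: eq_bigr => k _; congr (_ * _).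
  by apply: eq_Rintegral => x _; rewrite !monomial_cubic /mon; ring.
have [c3|c3] := eqVneq #|P| 3%N; last first.
  apply: empty => m; apply/negP => /andP[/eqP m3 /eqP mP].
  by have := cubic_degree m3; rewrite mP; lia.
have [m0 /andP[/eqP m3 /eqP mP]|none] := pickP (parity_class P); last first.
  by apply: empty => m; rewrite none.
have cl m : parity_class P m = (m == m0).
  apply/idP/eqP => [/andP[/eqP m3' /eqP mP']|->].
    by apply: multilinear_inj => //; rewrite mP.
  by rewrite /parity_class m3 mP !eqxx.
rewrite !(big_pred1 m0)//.
have c0 : #|odd_part m0| = 3%N by rewrite mP.
have [i [j [k [ij ik jk mE]]]] := monomial_multilinear R m3 c0.
have -> : gram m0 m0 = moment eta i j k.
  by apply: eq_Rintegral => x _; rewrite !mE /mon; ring.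
rewrite (moment3_eq eta_inv ij ik jk (isT : ord0 != lift ord0 (Ordinal (ltnW n2)))
  (isT : ord0 != lift ord0 (Ordinal n2))
  (isT : lift ord0 (Ordinal (ltnW n2)) != lift ord0 (Ordinal n2))).
rewrite -expr2 mulrC; apply: ler_wpM2l; first exact: sqr_ge0.
apply: le_trans (moment_q_ge eta_inv eta_iso eta_lc n2).
have K1 := sixth_bound_ge1 R.
have K3 : 3 * K <= 128 * K ^+ 3.
  have : 1 <= K ^+ 2 by rewrite exprn_ege1.
  nra.
apply: (@le_trans _ _ (1 - 128 * K ^+ 3 / n.+1%:R)).
  by rewrite lerD2r; lra.
by rewrite lerD2l lerN2 ler_pM2r.
Qed.

Lemma gram_form_bound (alpha : index -> R) : (2 <= n)%N -> 6 * K <= n.+1%:R ->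
  (108 / 175 - 128 * K ^+ 3 / n.+1%:R) * \sum_(m : index | mdeg m == 3%N) alpha m ^+ 2 <=
  \sum_(m : index | mdeg m == 3%N) \sum_(m' : index | mdeg m' == 3%N)
    alpha m * alpha m' * gram m m'.
Proof.
move=> n2 KN.
rewrite (partition_big (@odd_part n) xpredT)//= mulr_sumr.
rewrite [leRHS](partition_big (@odd_part n) xpredT)//=.
apply: ler_sum => P _; apply: le_trans (parity_class_bound alpha P n2 KN) _.
rewrite le_eqVlt; apply/orP; left; apply/eqP.
apply: eq_bigr => m /andP[/eqP m3 /eqP mP].
rewrite [RHS](bigID (fun m' => odd_part m' == P))/= [X in _ + X]big1 ?addr0//.
move=> m' /andP[/eqP m3' mP']; rewrite gram_parity ?mulr0//.
by rewrite mP eq_sym.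
Qed.

Lemma meval_sq_expectation (f : mpoly n.+1 R) : f \is @ishomog1 n.+1 R 3 mdeg ->
  ('E_eta[fun x : T => (meval (tnth x) f ^+ 2)%R] =
   (\sum_(m : index | mdeg m == 3%N) \sum_(m' : index | mdeg m' == 3%N)
      mcoeff m f * mcoeff m' f * gram m m')%:E)%E.
Proof.
move=> hf.
have sqE x : meval (tnth x) f ^+ 2 =
    \sum_(p : index * index | (mdeg p.1 == 3%N) && (mdeg p.2 == 3%N))
      mcoeff p.1 f * mcoeff p.2 f * (monomial p.1 x * monomial p.2 x).
  rewrite -(pair_big (fun m : index => mdeg m == 3%N) (fun m : index => mdeg m == 3%N)
    (fun m m' => mcoeff m f * mcoeff m' f * (monomial m x * monomial m' x))) /=.
  rewrite meval_cubic// expr2 mulr_suml; apply: eq_bigr => m _.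
  by rewrite mulr_sumr; apply: eq_bigr => m' _; rewrite mulrACA.
have dp (p : index * index) : (mdeg p.1 == 3%N) && (mdeg p.2 == 3%N) ->
    dominated (fun x : T => monomial p.1 x * monomial p.2 x).
  by move=> /andP[/eqP m3 /eqP m3']; exact: dominated_monomialM.
rewrite unlock; under eq_integral do rewrite sqE.
rewrite (pair_big (fun m : index => mdeg m == 3%N) (fun m : index => mdeg m == 3%N)
  (fun m m' => mcoeff m f * mcoeff m' f * gram m m')) /=.
rewrite -(Rintegral_lincomb eta_inv eta_iso eta_lc _ _ dp) /Rintegral fineK//.
apply: integrable_fin_num => //.
apply: (dominated_integrable eta_inv eta_iso eta_lc).
by apply: dominated_sum => p pp; apply: dominatedZ; exact: dp.
Qed.

End second_moment_of_cubic.

Local Close Scope classical_set_scope.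

Theorem proposition4p13 (R : realType) :
  exists C : R, forall (n : nat) (eta : probability (n.-tuple R) R)
      (f : mpoly n R),
    (0 < n)%N ->
    Hn_invariant eta -> log_concave eta -> isotropic eta ->
    f \is @ishomog1 n R 3 mdeg ->
    coeff3 f = 1 ->
    ((108%:R / 175%:R - C / n%:R)%:E <=
       'E_eta[fun x : n.-tuple R => (meval (tnth x) f ^+ 2)%R])%E.
Proof.
pose K := sixth_bound R; have K1 : 1 <= K := sixth_bound_ge1 R.
have K3 : K <= K ^+ 3.
  have : 1 <= K ^+ 2 by rewrite exprn_ege1.
  nra.
exists (128 * K ^+ 3) => -[//|n] eta f _ inv lc iso hf f1.
have N0 : 0 < n.+1%:R :> R by rewrite ltr0n.
have [KN|KN] := leP (6 * K) n.+1%:R; last first.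
  apply: (@le_trans _ _ 0%E); last by apply: expectation_ge0 => x; exact: sqr_ge0.
  rewrite lee_fin subr_le0 ler_pdivlMr//.
  have : 108 / 175 * n.+1%:R <= 108 / 175 * (6 * K) by rewrite ler_pM2l// ltW.
  lra.
have n2 : (2 <= n)%N.
  rewrite -ltnS -(ltr_nat R); apply: lt_le_trans KN; lra.
rewrite meval_sq_expectation// lee_fin.
apply: le_trans (gram_form_bound inv iso lc (fun m => mcoeff m f) n2 KN).
suff -> : \sum_(m : bmultinom n.+1 4 | mdeg m == 3%N) mcoeff m f ^+ 2 = 1.
  by rewrite mulr1.
rewrite -[LHS]sqr_sqrtr; first by rewrite -/(coeff3 f) f1 expr1n.
by apply: sumr_ge0 => m _; exact: sqr_ge0.
Qed.
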